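(* Thompson's group $F$ is exact if and only if Thompson's group $T$ is exact.
   Context: Thompson's group $V$ consists of the piecewise linear, right continuous bijections of $[0,1)$ which have finitely many points of non-differentiability, all being dyadic rationals, and whose derivative is an integer power of $2$ at each point of differentiability. Thompson's group $T$ is the subgroup of $V$ consisting of elements which have at most one point of discontinuity (as maps of $[0,1)$); identifying $[0,1)$ with $S^1$ via $\theta\mapsto e^{2\pi i\theta}$, elements of $T$ are homeomorphisms of $S^1$. Thompson's group $F$ is the subgroup of $T$ which stabilizes $1\in S^1$. Groups are regarded as discrete; a discrete group is exact if its reduced group $C^*$-algebra is exact (equivalently, if it admits a topologically amenable action on some compact Hausdorff space). *)

(* Defs.v *)
From HB Require Import structures.
From mathcomp Require Import all_boot all_order all_algebra.
From mathcomp Require Import all_classical all_reals all_analysis.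
From mathcomp Require Import ring lra zify.

Set Implicit Arguments.
Unset Strict Implicit.
Unset Printing Implicit Defensive.

Import Order.TTheory GRing.Theory Num.Theory.
Import numFieldNormedType.Exports.

Local Open Scope classical_set_scope.
Local Open Scope ring_scope.

(* The symmetric group of a possibly infinite type T: the product is
   composition, (f * g) x = f (g x). *)
Record permutation (T : Type) := Permutation {
  perm_fun :> T -> T;
  _ : `[< bijective perm_fun >] }.

HB.instance Definition _ (T : Type) := [isSub for @perm_fun T].
HB.instance Definition _ (T : choiceType) :=
  [Choice of permutation T by <:].

Section PermutationGroup.
Variable T : choiceType.
Implicit Types f g h : permutation T.

Lemma perm_bij f : bijective f.
Proof. by apply/asboolP; case: f. Qed.

Lemma perm_inj f : injective f.
Proof. exact: bij_inj (perm_bij f). Qed.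

Lemma perm_inv_ex f : exists g : T -> T, cancel f g /\ cancel g f.
Proof. by have [g fK gK] := perm_bij f; exists g. Qed.

Definition perm_inv_fun f : T -> T := sval (cid (perm_inv_ex f)).

Lemma perm_funK f : cancel f (perm_inv_fun f).
Proof. exact: (svalP (cid (perm_inv_ex f))).1. Qed.

Lemma perm_inv_funK f : cancel (perm_inv_fun f) f.
Proof. exact: (svalP (cid (perm_inv_ex f))).2. Qed.

Lemma perm_one_subproof : `[< bijective (@id T) >].
Proof. by apply/asboolP; exists id. Qed.

Lemma perm_mul_subproof f g : `[< bijective (f \o g) >].
Proof. by apply/asboolP; apply: bij_comp; exact: perm_bij. Qed.

Lemma perm_inv_subproof f : `[< bijective (perm_inv_fun f) >].
Proof.
by apply/asboolP; exists f; [exact: perm_inv_funK|exact: perm_funK].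
Qed.

Definition perm_one : permutation T := Permutation perm_one_subproof.
Definition perm_mul f g : permutation T := Permutation (perm_mul_subproof f g).
Definition perm_inv f : permutation T := Permutation (perm_inv_subproof f).

Lemma perm_mulA : associative perm_mul.
Proof. by move=> f g h; exact: val_inj. Qed.

Lemma perm_mul1 : left_id perm_one perm_mul.
Proof. by move=> f; exact: val_inj. Qed.

Lemma perm_mulr1 : right_id perm_one perm_mul.
Proof. by move=> f; exact: val_inj. Qed.

Lemma perm_mulV : left_inverse perm_one perm_inv perm_mul.
Proof.
by move=> f; apply: val_inj; apply/funext => x /=; exact: perm_funK.
Qed.

Lemma perm_mulrV : right_inverse perm_one perm_inv perm_mul.
Proof.
by move=> f; apply: val_inj; apply/funext => x /=; exact: perm_inv_funK.
Qed.

HB.instance Definition _ := isGroup.Build (permutation T)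
  perm_mulA perm_mul1 perm_mulr1 perm_mulV perm_mulrV.

End PermutationGroup.

Section Thompson.
Variable R : realType.
Implicit Types (f : R -> R) (x : R).

Definition dyadic : set R :=
  [set x | exists (m : int) (n : nat), x = m%:~R / 2 ^+ n].

(* f is affine on every open subinterval of [0, 1) that avoids a fixed finite
   list s of break points. *)
Definition piecewise_linear f := exists s : seq R, forall a b : R,
  0 <= a -> b <= 1 -> (forall c, c \in s -> c \notin `]a, b[) ->
  exists p q : R, forall x, x \in `]a, b[ -> f x = p * x + q.

(* Only interior points are considered: at the endpoint 0, which is dyadic
   anyway, a map of [0, 1) has at most a one-sided derivative, and for a right
   continuous piecewise linear map it is the slope at the points just after 0. *)
Definition nondifferentiable f : set R :=
  [set x : R | (x \in `]0, 1[) /\ ~ derivable f x 1].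

(* Discontinuity as a map of [0, 1), hence the limit within [0, 1). *)
Definition discontinuous f : set R :=
  [set x : R | (x \in `[0, 1[) /\ ~ (f @ within [set` `[0, 1[] (nbhs x) --> f x)].

(* A bijection of [0, 1) is encoded as a permutation of R that is the identity
   outside [0, 1); such a permutation restricts to a bijection of [0, 1), and
   every bijection of [0, 1) arises in this way exactly once. *)
Record is_thompsonV f : Prop := IsThompsonV {
  thompsonV_out : forall x, x \notin `[0, 1[ -> f x = x;
  thompsonV_linear : piecewise_linear f;
  thompsonV_right : forall x, x \in `[0, 1[ -> f @ x^'+ --> f x;
  thompsonV_finite : finite_set (nondifferentiable f);
  thompsonV_dyadic : nondifferentiable f `<=` dyadic;
  thompsonV_slope : forall x, x \in `]0, 1[ -> derivable f x 1 ->
    exists k : int, f^`()%classic x = 2 ^ k }.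

Definition is_thompsonT f := is_thompsonV f /\ is_subset1 (discontinuous f).
(* The point 1 of the circle corresponds to 0 in [0, 1). *)
Definition is_thompsonF f := is_thompsonT f /\ f 0 = 0.

Definition in_thompsonV : pred (permutation R) :=
  fun f : permutation R => `[< is_thompsonV f >].
Definition in_thompsonT : pred (permutation R) :=
  fun f : permutation R => `[< is_thompsonT f >].
Definition in_thompsonF : pred (permutation R) :=
  fun f : permutation R => `[< is_thompsonF f >].

Local Ltac ilia := repeat match goal with
  | H : ?T |- _ => match T with context [R] => clear H end end; lia.

Definition dyadic_level (n : int) x := x * 2 ^ n \is a Num.int.
Local Notation lev := dyadic_level.

Lemma exp2_neq0 (n : int) : (2 : R) ^ n != 0.
Proof. by rewrite expfz_neq0 ?pnatr_eq0. Qed.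

Lemma exp2_gt0 (n : int) : 0 < (2 : R) ^ n.
Proof. by rewrite exprz_gt0. Qed.

Lemma exp2D (m n : int) : (2 : R) ^ (m + n) = 2 ^ m * 2 ^ n.
Proof. by rewrite expfzDr ?pnatr_eq0. Qed.

Lemma exp2N (n : int) : (2 : R) ^ n * 2 ^ (- n) = 1.
Proof. by rewrite -exp2D subrr expr0z. Qed.

Lemma exp2_int (n : int) : 0 <= n -> (2 : R) ^ n \is a Num.int.
Proof. by case: n => // n _; rewrite -exprnP rpredX// rpred_nat. Qed.

Lemma lev_le (m n : int) x : m <= n -> lev m x -> lev n x.
Proof.
move=> mn; rewrite /lev => h.
have -> : n = m + (n - m) by rewrite addrC subrK.
by rewrite exp2D mulrA rpredM// exp2_int// subr_ge0.
Qed.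

Lemma levD n x y : lev n x -> lev n y -> lev n (x + y).
Proof. by rewrite /lev mulrDl; exact: rpredD. Qed.

Lemma levN n x : lev n x -> lev n (- x).
Proof. by rewrite /lev mulNr rpredN. Qed.

Lemma levB n x y : lev n x -> lev n y -> lev n (x - y).
Proof. by move=> hx hy; apply: levD => //; exact: levN. Qed.

Lemma lev0 n : lev n 0.
Proof. by rewrite /lev mul0r. Qed.

Lemma lev_exp2 (n k : int) : 0 <= k + n -> lev n (2 ^ k).
Proof. by move=> h; rewrite /lev -exp2D exp2_int. Qed.

Lemma lev1 (n : nat) : lev n 1.
Proof. by rewrite /lev mul1r exp2_int. Qed.

Lemma lev_mul (n k : int) x : lev n x -> lev (n - k) (2 ^ k * x).
Proof.
rewrite /lev => h; rewrite mulrC mulrA -exp2D subrK mulrC //.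
Qed.

Lemma dyadicP x : dyadic x <-> exists n : nat, lev n x.
Proof.
split=> [[m [n ->]]|[n]]; first by exists n; rewrite /lev -exprnP divfK// expf_neq0 ?pnatr_eq0.
rewrite /lev => /intrP[m hm]; exists m, n.
by rewrite -hm -exprnP mulfK// expf_neq0 ?pnatr_eq0.
Qed.

Lemma lev_gap n x y : lev n x -> lev n y -> x < y -> x + 2 ^ (- n) <= y.
Proof.
move=> hx hy xy; have : lev n (y - x) by exact: levB.
rewrite /lev => /intrP[m hm].
have m0 : (0 : R) < m%:~R by rewrite -hm mulr_gt0 ?exp2_gt0// subr_gt0.
have m1 : (1 : R) <= m%:~R.
  by rewrite ler1z -gtz0_ge1 -(ltr0z R).
rewrite -hm in m1.
have := ler_wpM2r (ltW (exp2_gt0 (- n))) m1.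
by rewrite mul1r -mulrA exp2N mulr1; lra.
Qed.

Lemma lev_floor n x : exists2 a, lev n a & a <= x < a + 2 ^ (- n).
Proof.
exists ((Num.floor (x * 2 ^ n))%:~R * 2 ^ (- n)).
  by rewrite /lev -mulrA [2 ^ (- n) * _]mulrC exp2N mulr1.
have e : x = x * 2 ^ n * 2 ^ (- n) by rewrite -mulrA exp2N mulr1.
have h0 := exp2_gt0 (- n).
rewrite [in X in _ <= X]e ler_pM2r// floor_le /=.
rewrite {1}e -[X in _ + X]mul1r -mulrDl ltr_pM2r//.
by rewrite -(intrD _ _ 1) floorD1_gt.
Qed.

Lemma lev_floor01 (n : nat) x : 0 <= x < 1 -> exists a,
  [/\ lev n a, a <= x < a + 2 ^ (- n%:Z), 0 <= a < 1 & a + 2 ^ (- n%:Z) <= 1].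
Proof.
move=> /andP[x0 x1]; have [a la /andP[ax xa]] := lev_floor n x.
have a1 : a < 1 by exact: le_lt_trans x1.
exists a; split => //; first exact/andP.
  rewrite a1 andbT leNgt; apply/negP => a0.
  by have := lev_gap la (lev0 n) a0; lra.
exact: lev_gap (lev1 n) a1.
Qed.

Lemma lev_finite (n : nat) : exists s : seq R,
  forall x, lev n x -> 0 <= x < 1 -> x \in s.
Proof.
exists [seq i%:R * 2 ^ (- n%:Z) | i <- iota 0 (2 ^ n)] => x.
rewrite /lev => /intrP[m hm] /andP[x0 x1].
have e : x = m%:~R * 2 ^ (- n%:Z) by rewrite -hm -mulrA exp2N mulr1.
have m0 : (0 : R) <= m%:~R by rewrite -hm mulr_ge0// ltW// exp2_gt0.
rewrite ler0z in m0; case: m m0 hm e => // m _ hm e.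
apply/mapP; exists m; last by rewrite e.
rewrite mem_iota add0n /=.
have : x * 2 ^ n < 1 * 2 ^ n by rewrite ltr_pM2r// exp2_gt0.
by rewrite hm mul1r -exprnP -natrX ltr_nat.
Qed.

Lemma seq_bound (s : seq R) (P : R -> nat -> Prop) :
  (forall a m n, (m <= n)%N -> P a m -> P a n) ->
  (forall a, a \in s -> exists n, P a n) ->
  exists n, forall a, a \in s -> P a n.
Proof.
move=> mono; elim: s => [|a s IH] h; first by exists 0%N.
have [m hm] := h a (mem_head _ _).
have [b bs|n hn] := IH; first by apply: h; rewrite in_cons bs orbT.
exists (maxn m n) => b; rewrite in_cons => /orP[/eqP ->|bs].
  by apply: mono hm; exact: leq_maxl.
by apply: mono (hn _ bs); exact: leq_maxr.
Qed.

Definition dyadic_grid (n : nat) f := forall a, lev n a -> 0 <= a < 1 ->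
  exists (k : int) (b : R), dyadic b /\
    forall x, a <= x < a + 2 ^ (- n%:Z) -> f x = 2 ^ k * x + b.

Lemma grid_bound n f : dyadic_grid n f -> exists M : nat,
  forall a, lev n a -> 0 <= a < 1 -> exists (k : int) (b : R),
  [/\ - M%:Z <= k, k <= M%:Z, lev M b &
    forall x, a <= x < a + 2 ^ (- n%:Z) -> f x = 2 ^ k * x + b].
Proof.
move=> gf; have [s hs] := lev_finite n.
pose P a (M : nat) := lev n a -> 0 <= a < 1 -> exists (k : int) (b : R),
  [/\ - M%:Z <= k, k <= M%:Z, lev M b &
    forall x, a <= x < a + 2 ^ (- n%:Z) -> f x = 2 ^ k * x + b].
have [|a _|M hM] := @seq_bound s P.
- move=> a m m' mm' Pm la a01; have [k [b [h1 h2 h3 h4]]] := Pm la a01.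
  exists k, b; split => //; [lia|lia|].
  by apply: lev_le h3; lia.
- case: (pselect (lev n a /\ 0 <= a < 1)) => [[la a01]|nla]; last first.
    by exists 0%N => la a01; exfalso; apply: nla.
  have [k [b [/dyadicP[M hM] h]]] := gf a la a01.
  exists (maxn M `|k|)%N => _ _; exists k, b; split => //; [lia|lia|].
  by apply: lev_le hM; lia.
- by exists M => a la a01; apply: hM => //; exact: hs.
Qed.

Lemma dyadicD x y : dyadic x -> dyadic y -> dyadic (x + y).
Proof.
move=> /dyadicP[m hm] /dyadicP[n hn]; apply/dyadicP; exists (m + n)%N.
by apply: levD; [apply: lev_le hm|apply: lev_le hn]; ilia.
Qed.

Lemma dyadicN x : dyadic x -> dyadic (- x).
Proof. by move=> /dyadicP[m hm]; apply/dyadicP; exists m; exact: levN. Qed.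

Lemma dyadic_mul (k : int) x : dyadic x -> dyadic (2 ^ k * x).
Proof.
move=> /dyadicP[m hm]; apply/dyadicP; exists `|m%:Z - k|%N.
by apply: lev_le (lev_mul k hm); ilia.
Qed.

Lemma dyadic_exp2 (k : int) : dyadic (2 ^ k : R).
Proof. by apply/dyadicP; exists `|k|%N; apply: lev_exp2; ilia. Qed.

Lemma dyadic0 : dyadic (0 : R).
Proof. by apply/dyadicP; exists 0%N; exact: lev0. Qed.

Definition maps01 f := forall x, 0 <= x < 1 -> 0 <= f x < 1.

Lemma grid_one : dyadic_grid 0 (@id R).
Proof.
move=> a _ _; exists 0, 0; split; first exact: dyadic0.
by move=> x _; rewrite expr0z mul1r addr0.
Qed.

Lemma grid_comp (n m : nat) f g : maps01 f ->
  dyadic_grid n f -> dyadic_grid m g -> exists p, dyadic_grid p (g \o f).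
Proof.
move=> f01 /grid_bound[M gf] gg; exists (n + M + M + m)%N.
set p := (n + M + M + m)%N.
move=> a la a01.
have [a0 [la0 /andP[a0a aa0] a001 _]] := lev_floor01 n a01.
have [k [b [kM Mk lb hf]]] := gf a0 la0 a001.
have fa01 := f01 _ a01.
have [c [lc /andP[cfa fac] c01 _]] := lev_floor01 m fa01.
have [l [d [dd hg]]] := gg c lc c01.
exists (l + k), (2 ^ l * b + d); split.
  apply: dyadicD => //; apply: dyadic_mul; apply/dyadicP; by exists M.
move=> x /andP[ax xa].
have xa0 : x < a0 + 2 ^ (- n%:Z).
  apply: lt_le_trans xa _; apply: lev_gap => //; apply: levD.
    by apply: lev_le la0; ilia.
  by apply: lev_exp2; ilia.
have fxE : f x = 2 ^ k * x + b by apply: hf; rewrite xa0 (le_trans a0a).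
have faE : f a = 2 ^ k * a + b by apply: hf; rewrite a0a aa0.
have lfa : lev (p%:Z - k) (f a).
  rewrite faE; apply: levD; first exact: lev_mul.
  by apply: lev_le lb; ilia.
have k0 := exp2_gt0 k.
have fax : f a <= f x by rewrite fxE faE lerD2r ler_pM2l.
have fxa : f x < c + 2 ^ (- m%:Z).
  apply: (@lt_le_trans _ _ (f a + 2 ^ (- (p%:Z - k)))).
    rewrite opprB exp2D fxE faE -addrA [b + _]addrC addrA ltrD2r -mulrDr.
    by rewrite ltr_pM2l.
  apply: lev_gap => //; apply: levD.
    by apply: lev_le lc; ilia.
  by apply: lev_exp2; ilia.
rewrite /= hg; last by rewrite fxa (le_trans cfa).
by rewrite fxE mulrDr mulrA -exp2D addrA.
Qed.

Lemma grid_inv (n : nat) f g : maps01 g -> cancel f g -> cancel g f ->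
  dyadic_grid n f -> exists p, dyadic_grid p g.
Proof.
move=> g01 fK gK /grid_bound[M gf]; exists (n + M + M)%N.
set p := (n + M + M)%N.
move=> y0 ly0 y001; have x01 := g01 _ y001.
have [a [la /andP[ax xa] a01 a1]] := lev_floor01 n x01.
have [k [b [kM Mk lb hf]]] := gf a la a01.
have k0 := exp2_gt0 k.
have y0E : y0 = 2 ^ k * g y0 + b by rewrite -hf ?gK// ax xa.
exists (- k), (- (2 ^ (- k) * b)); split.
  by apply: dyadicN; apply: dyadic_mul; apply/dyadicP; exists M.
move=> y /andP[y0y yy0].
have yend : y0 + 2 ^ (- p%:Z) <= 2 ^ k * (a + 2 ^ (- n%:Z)) + b.
  apply: lev_gap => //; last by rewrite [y0]y0E ltrD2r ltr_pM2l.
  apply: levD; last by apply: lev_le lb; ilia.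
  rewrite mulrDr -exp2D; apply: levD; last by apply: lev_exp2; ilia.
  by apply: lev_le (lev_mul k la); ilia.
have e (z : R) : 2 ^ k * (2 ^ (- k) * z) = z by rewrite mulrA exp2N mul1r.
pose x := 2 ^ (- k) * (y - b).
have xE : 2 ^ k * x + b = y by rewrite e subrK.
have fx : f x = y.
  rewrite hf //; apply/andP; split.
    rewrite -(ler_pM2l k0) -(lerD2r b) xE; apply: le_trans y0y.
    by rewrite [y0]y0E lerD2r ler_pM2l.
  by rewrite -(ltr_pM2l k0) -(ltrD2r b) xE (lt_le_trans yy0).
by rewrite -[in LHS]fx fK /x mulrBr.
Qed.

Lemma affine_cvg (p q c : R) : (fun y => p * y + q) @ c --> p * c + q.
Proof. by apply: cvgD; [apply: cvgM; [exact: cvg_cst|exact: cvg_id]|exact: cvg_cst]. Qed.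

Lemma affine_derivable (p q c : R) : derivable (fun y : R => p * y + q) c 1.
Proof. by apply: derivableD => //; apply: derivableM. Qed.

Lemma right_affine f (c b p q : R) : c < b ->
  (forall y, c < y < b -> f y = p * y + q) -> f @ c^'+ --> p * c + q.
Proof.
move=> cb h; apply: (cvg_trans _ (cvg_at_right_filter (@affine_cvg p q c))).
apply: near_eq_cvg; near=> y; rewrite h //; apply/andP; split; near: y.
  exact: nbhs_right_gt.
exact: nbhs_right_lt.
Unshelve. all: end_near. Qed.

Lemma left_affine f (a c p q : R) : a < c ->
  (forall y, a < y < c -> f y = p * y + q) -> f @ c^'- --> p * c + q.
Proof.
move=> cb h; apply: (cvg_trans _ (cvg_at_left_filter (@affine_cvg p q c))).
apply: near_eq_cvg; near=> y; rewrite h //; apply/andP; split; near: y.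
  exact: nbhs_left_gt.
exact: nbhs_left_lt.
Unshelve. all: end_near. Qed.

Lemma derivable_cvg f (c : R) : derivable f c 1 -> f @ c --> f c.
Proof. by move=> /derivable1_diffP/differentiable_continuous. Qed.

Lemma derive_quot f (c : R) : derivable f c 1 ->
  cvg ((fun h => h^-1 *: (f (h + c) - f c)) @ 0^').
Proof.
rewrite /derivable.
have -> : (fun h : R => h^-1 *: ((f \o shift c) (h *: 1) - f c)) =
          (fun h => h^-1 *: (f (h + c) - f c)).
  by apply/funext => h /=; rewrite [h *: 1]mulr1.
by [].
Qed.

Lemma derive_right f (c b p q : R) : derivable f c 1 -> c < b ->
  (forall y, c < y < b -> f y = p * y + q) ->
  f c = p * c + q /\ f^`()%classic c = p.
Proof.
move=> df cb h.
have fc : f c = p * c + q.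
  apply: (cvg_unique _ _ (right_affine cb h)) => //.
  exact: cvg_at_right_filter (derivable_cvg df).
split => //; rewrite /derive1 cvg_at_rightE; last exact: derive_quot.
apply: norm_lim_near_cst; near=> t.
have t0 : 0 < t by near: t; exact: nbhs_right_gt.
have tb : t < b - c by near: t; apply: nbhs_right_lt; rewrite subr_gt0.
rewrite h ?fc; last by lra.
rewrite [LHS](_ : _ = t^-1 * (p * (t + c) + q - (p * c + q)))//.
by field; rewrite gt_eqF.
Unshelve. all: end_near. Qed.

Lemma derive_left f (a c p q : R) : derivable f c 1 -> a < c ->
  (forall y, a < y < c -> f y = p * y + q) ->
  f c = p * c + q /\ f^`()%classic c = p.
Proof.
move=> df cb h.
have fc : f c = p * c + q.
  apply: (cvg_unique _ _ (left_affine cb h)) => //.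
  exact: cvg_at_left_filter (derivable_cvg df).
split => //; rewrite /derive1 cvg_at_leftE; last exact: derive_quot.
apply: norm_lim_near_cst; near=> t.
have t0 : t < 0 by near: t; exact: nbhs_left_lt.
have tb : a - c < t by near: t; apply: nbhs_left_gt; rewrite subr_lt0.
rewrite h ?fc; last by lra.
rewrite [LHS](_ : _ = t^-1 * (p * (t + c) + q - (p * c + q)))//.
by field; rewrite lt_eqF.
Unshelve. all: end_near. Qed.

Lemma grid_thompsonV (n : nat) f :
  (forall x, x \notin `[0, 1[ -> f x = x) -> dyadic_grid n f -> is_thompsonV f.
Proof.
move=> fout gf.
have [s hs] := lev_finite n.
have ndl : nondifferentiable f `<=` [set x | lev n x /\ 0 <= x < 1].
  move=> x [] /=; rewrite in_itv /= => /andP[x0 x1] ndx.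
  have x01 : 0 <= x < 1 by rewrite (ltW x0) x1.
  split => //; apply: contrapT => nl; apply: ndx.
  have [a [la /andP[ax xa] a01 a1]] := lev_floor01 n x01.
  have [k [b [_ h]]] := gf a la a01.
  apply: (near_eq_derivable _ (@affine_derivable (2 ^ k) b x)).
  have ax' : a < x.
    by rewrite lt_neqAle ax andbT; apply/eqP => e; apply: nl; rewrite -e.
  near=> y; rewrite h //; apply/andP; split.
    by apply: ltW; near: y; exact: lt_nbhsr.
  by near: y; exact: lt_nbhsl.
split=> //.
- exists s => a b a0 b1 nos.
  have [ab|ba] := ltP a b; last first.
    by exists 0, 0 => x; rewrite in_itv /= => /andP[ax xb]; exfalso; lra.
  have a01 : 0 <= a < 1 by rewrite a0; lra.
  have [c [lc /andP[ca ac] c01 c1]] := lev_floor01 n a01.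
  have [k [d [_ h]]] := gf c lc c01.
  have bc : b <= c + 2 ^ (- n%:Z).
    rewrite leNgt; apply/negP => cb.
    have /nos : c + 2 ^ (- n%:Z) \in s.
      apply: hs; last by lra.
      by apply: levD => //; apply: lev_exp2; ilia.
    by rewrite in_itv /= ac cb.
  exists (2 ^ k), d => x; rewrite in_itv /= => /andP[ax xb].
  by apply: h; lra.
- move=> x; rewrite in_itv /= => x01.
  have [c [lc /andP[cx xc] c01 c1]] := lev_floor01 n x01.
  have [k [d [_ h]]] := gf c lc c01.
  rewrite h ?cx//; apply: (right_affine xc) => y /andP[xy yc].
  by apply: h; lra.
- apply: (@sub_finite_set _ _ [set` s]); last exact: finite_seq.
  by move=> x /ndl[lx x01]; exact: hs.
- by move=> x /ndl[lx _]; apply/dyadicP; exists n.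
- move=> x; rewrite in_itv /= => /andP[x0 x1] dfx.
  have x01 : 0 <= x < 1 by rewrite (ltW x0).
  have [c [lc /andP[cx xc] c01 c1]] := lev_floor01 n x01.
  have [k [d [_ h]]] := gf c lc c01.
  exists k; apply: (proj2 (derive_right dfx xc (q := d) _)) => y /andP[xy yc].
  by apply: h; lra.
Unshelve. all: end_near. Qed.

Definition affine_off (s : seq R) f := forall a b : R,
  0 <= a -> b <= 1 -> (forall c, c \in s -> c \notin `]a, b[) ->
  exists p q : R, forall x, x \in `]a, b[ -> f x = p * x + q.

Lemma affine_off_derivable f (c : R) s :
  (0 < c < 1 -> derivable f c 1) -> affine_off (c :: s) f -> affine_off s f.
Proof.
move=> dfc h a b a0 b1 nos.
have [cab|ncab] := boolP (c \in `]a, b[); last first.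
  by apply: h => // d; rewrite in_cons => /orP[/eqP ->|/nos].
move: cab; rewrite in_itv /= => /andP[ac cb].
have {}dfc : derivable f c 1 by apply: dfc; lra.
have [|d|p [q hpq]] := h a c a0 _.
- by lra.
- rewrite in_cons in_itv /= => /orP[/eqP ->|/nos]; first by rewrite ltxx andbF.
  by rewrite in_itv /=; apply: contra => /andP[-> dc]; exact: lt_trans cb.
have [||d|p' [q' hpq']] := h c b.
- by lra.
- by lra.
- rewrite in_cons in_itv /= => /orP[/eqP ->|/nos]; first by rewrite ltxx.
  by rewrite in_itv /=; apply: contra => /andP[cd ->]; rewrite andbT; exact: lt_trans cd.
have [|e1 e2] := derive_left dfc ac (p := p) (q := q).
  by move=> y hy; apply: hpq; rewrite in_itv.
have [|e3 e4] := derive_right dfc cb (p := p') (q := q').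
  by move=> y hy; apply: hpq'; rewrite in_itv.
exists p, q => x; rewrite in_itv /= => /andP[ax xb].
have ep : p' = p by rewrite -e2 -e4.
have eq' : q' = q by move: e3; rewrite e1 ep; lra.
have [xc|cx|->//] := ltgtP x c.
  by apply: hpq; rewrite in_itv /= ax.
by rewrite hpq' ?ep ?eq'// in_itv /= cx.
Qed.

Lemma affine_off_nondiff f s : affine_off s f -> exists t,
  affine_off t f /\ forall c, c \in t -> nondifferentiable f c.
Proof.
suff gen t : affine_off (s ++ t) f ->
    (forall c, c \in t -> nondifferentiable f c) ->
    exists t', affine_off t' f /\ forall c, c \in t' -> nondifferentiable f c.
  by move=> h; apply: (gen [::]); rewrite ?cats0.
elim: s t => [|c s IH] t h ht; first by exists t.
have [nd|nnd] := pselect (nondifferentiable f c).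
  apply: (IH (c :: t)); last first.
    by move=> d; rewrite in_cons => /orP[/eqP ->|/ht].
  move=> a b a0 b1 nos; apply: h => // d hd; apply: nos; move: hd.
  by rewrite /= !(in_cons, mem_cat) orbCA.
apply: (IH t) => //; apply: affine_off_derivable h => c01.
by apply: contrapT => ndc; apply: nnd; split => //; rewrite in_itv.
Qed.

Lemma thompsonV_affine f : is_thompsonV f -> exists n : nat,
  forall a, lev n a -> 0 <= a < 1 -> exists (k : int) (b : R),
  forall x, a <= x < a + 2 ^ (- n%:Z) -> f x = 2 ^ k * x + b.
Proof.
case=> fout [s0 /affine_off_nondiff[s [hs snd]]] rc _ dy sl.
have [n hn] : exists n : nat, forall c, c \in s -> lev n c.
  apply: seq_bound => [c i j ij|c /snd/dy/dyadicP//].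
  by apply: lev_le; ilia.
exists n => a la /andP[a0 a1].
have e0 := exp2_gt0 (- n%:Z).
set e := 2 ^ (- n%:Z) in e0 *.
have ae1 : a + e <= 1 by apply: lev_gap => //; exact: lev1.
have [//|//|c cs|p [q h]] := hs a (a + e).
  apply/negP; rewrite in_itv /= => /andP[ac ca].
  by have := lev_gap la (hn _ cs) ac; rewrite -/e; lra.
have h' y : a < y < a + e -> f y = p * y + q by move=> hy; apply: h; rewrite in_itv.
have fa : f a = p * a + q.
  have ae : a < a + e by lra.
  apply: (cvg_unique _ _ (right_affine ae h')) => //.
  by apply: rc; rewrite in_itv /= a0 a1.
pose x := a + e / 2.
have [k hk] : exists k : int, p = 2 ^ k.
  have dfx : derivable f x 1.
    apply: (near_eq_derivable _ (@affine_derivable p q x)).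
    near=> y; rewrite h' //; apply/andP; split.
      by near: y; apply: lt_nbhsr; rewrite /x; lra.
    by near: y; apply: lt_nbhsl; rewrite /x; lra.
  have [|k hk] := sl x _ dfx; first by rewrite in_itv /= /x; lra.
  exists k; rewrite -hk; apply/esym.
  apply: (proj2 (@derive_right f x (a + e) p q dfx _ _)); first by rewrite /x; lra.
  by move=> y; rewrite /x => hy; apply: h'; lra.
exists k, q; rewrite -hk => y /andP[]; rewrite le_eqVlt => /orP[/eqP <- _ //|ay ya].
by apply: h'; rewrite ay.
Unshelve. all: end_near. Qed.

Lemma thompsonV_grid f : maps01 f -> {in `[0, 1[ &, injective f} ->
  set_surj `[0, 1[ `[0, 1[ f -> is_thompsonV f -> exists n, dyadic_grid n f.
Proof.
move=> f01 finj fsurj /thompsonV_affine[n gf]; exists n.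
have e0 := exp2_gt0 (- n%:Z).
suff fa_dy a : lev n a -> 0 <= a < 1 -> dyadic (f a).
  move=> a la a01; have [k [b h]] := gf a la a01.
  exists k, b; split => //.
  have -> : b = f a + - (2 ^ k * a) by rewrite h; lra.
  apply: dyadicD; first exact: fa_dy.
  by apply/dyadicN/dyadic_mul/dyadicP; exists n.
have [s hs] := lev_finite n.
suff claim (m : nat) : forall a, lev n a -> 0 <= a < 1 ->
    (size [seq c <- s | (f c < f a)%R] < m)%N -> dyadic (f a).
  by move=> la a01; exact: (claim _ _ la a01 (ltnSn _)).
move=> {a}; elim: m => // m IH a la a01; rewrite ltnS => sz.
have /andP[fa0 fa1] := f01 _ a01.
move: fa0; rewrite le_eqVlt => /orP[/eqP <-|fa0]; first exact: dyadic0.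
suff [a' [la' a'01 fa'a [k [b [hk <-]]]]] : exists a', [/\ lev n a', 0 <= a' < 1,
    f a' < f a & exists k b, (forall x, a' <= x < a' + 2 ^ (- n%:Z) ->
    f x = 2 ^ k * x + b) /\ f a' + 2 ^ k * 2 ^ (- n%:Z) = f a].
  rewrite -exp2D; apply: dyadicD; last exact: dyadic_exp2.
  apply: IH => //; apply: leq_trans sz.
  rewrite !size_filter.
  have := count_predUI (fun c => f c < f a') (fun c => f a' <= f c < f a) s.
  rewrite (@eq_count _ (predI _ _) pred0); last first.
    by move=> c /=; apply/negbTE/negP => /and3P[]; lra.
  rewrite count_pred0 addn0 (@eq_count _ (predU _ _) (fun c => f c < f a)); last first.
    by move=> c /=; case: (ltP (f c) (f a')) => //= h; apply/esym; lra.
  move=> ->; rewrite -[X in (X < _)%N]addn0 ltn_add2l -has_count.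
  by apply/hasP; exists a'; [exact: hs|rewrite lexx].
apply: contrapT => noend.
have below c : lev n c -> 0 <= c < 1 -> f c < f a -> exists y, [/\ 0 <= y, y < f a &
    forall x, c <= x < c + 2 ^ (- n%:Z) -> f x <= y].
  move=> lc c01 fca; have [k [b h]] := gf c lc c01.
  have k0 := exp2_gt0 k.
  have fcE : f c = 2 ^ k * c + b by apply: h; lra.
  have /andP[fc0 _] := f01 _ c01.
  have kn0 : 0 < 2 ^ k * 2 ^ (- n%:Z) :> R by exact: mulr_gt0.
  have end_le : f c + 2 ^ k * 2 ^ (- n%:Z) < f a.
    rewrite lt_neqAle; apply/andP; split.
      apply/eqP => e; apply: noend; exists c; split => //.
      by exists k, b.
    rewrite leNgt; apply/negP => fac.
    pose x := c + 2 ^ (- k) * (f a - f c).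
    have kx : 2 ^ k * x = 2 ^ k * c + (f a - f c).
      by rewrite /x mulrDr mulrA exp2N mul1r.
    have cx : c < x.
      by rewrite /x ltrDl mulr_gt0 ?exp2_gt0// subr_gt0.
    have xc : x < c + 2 ^ (- n%:Z).
      rewrite -(ltr_pM2l k0) kx mulrDr; lra.
    have c1 : c + 2 ^ (- n%:Z) <= 1.
      by apply: lev_gap => //; [exact: lev1|lra].
    have fxa : f x = f a by rewrite h ?kx ?fcE; lra.
    have /finj : x \in `[0, 1[ by rewrite in_itv /=; lra.
    have aI : a \in `[0, 1[ by rewrite in_itv.
    move=> /(_ _ aI fxa) xa; rewrite -xa in la.
    by have := lev_gap lc la cx; lra.
  exists (f c + 2 ^ k * 2 ^ (- n%:Z)); split => //; first by lra.
  move=> x /andP[cx xc]; rewrite h ?cx// fcE -addrA [b + _]addrC addrA lerD2r -mulrDr.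
  by rewrite ler_pM2l// ltW.
have [y [y0 ya hy]] : exists y, [/\ 0 <= y, y < f a &
    forall c, c \in s -> lev n c -> 0 <= c < 1 -> f c < f a ->
    forall x, c <= x < c + 2 ^ (- n%:Z) -> f x <= y].
  elim: (s) => [|c t [y [y0 ya hy]]]; first by exists 0.
  have [[lc c01 fca]|nc] := pselect [/\ lev n c, 0 <= c < 1 & f c < f a]; last first.
    exists y; split => // d; rewrite in_cons => /orP[/eqP -> *|/hy//].
    by exfalso; apply: nc.
  have [z [z0 za hz]] := below c lc c01 fca.
  exists (Num.max y z); split; first by rewrite le_max y0.
    by rewrite gt_max ya.
  move=> d; rewrite in_cons => /orP[/eqP -> _ _ _ x hx|dt ld d01 fda x hx].
    by rewrite le_max hz// orbT.
  by rewrite le_max (hy d).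
pose z := (y + f a) / 2.
have [|x /=] := fsurj z; first by rewrite /= in_itv /= /z; lra.
rewrite in_itv /= => x01 fxz.
have [c [lc /andP[cx xc] c01 c1]] := lev_floor01 n x01.
have [k [b h]] := gf c lc c01.
have fcx : f c <= f x.
  by rewrite !h ?cx ?xc ?lexx ?ltrDl ?e0// lerD2r ler_pM2l// exp2_gt0.
have fca : f c < f a by move: fxz; rewrite /z; lra.
have := hy c (hs _ lc c01) lc c01 fca x; rewrite cx xc => /(_ isT).
by rewrite fxz /z; lra.
Qed.

Definition cyclic (x y z : R) :=
  [|| x < y < z, y < z < x | z < x < y].

Definition preserves_cyclic f := forall x y z,
  0 <= x < 1 -> 0 <= y < 1 -> 0 <= z < 1 -> cyclic x y z ->
  cyclic (f x) (f y) (f z).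

Lemma cyclic_wlog f : (forall x y z, 0 <= x -> x < y -> y < z -> z < 1 ->
  cyclic (f x) (f y) (f z)) -> preserves_cyclic f.
Proof.
move=> h x y z /andP[x0 x1] /andP[y0 y1] /andP[z0 z1].
case/or3P => /andP[ab bc].
- exact: h.
- by have := h y z x y0 ab bc x1; rewrite /cyclic => /or3P[] ->; rewrite ?orbT.
- by have := h z x y z0 ab bc y1; rewrite /cyclic => /or3P[] ->; rewrite ?orbT.
Qed.

Lemma continuous_part f (p u v : R) : is_thompsonV f ->
  0 <= u -> v <= 1 ->
  (forall x, discontinuous f x -> x < u \/ v <= x \/ x = u) ->
  {within `[u, v[, continuous f}.
Proof.
move=> fV u0 v1 hd; apply/subspace_continuousP => x /=.
rewrite in_itv /= => /andP[ux xv].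
have x01 : x \in `[0, 1[ by rewrite in_itv /=; lra.
have [xu|xu] := eqVneq x u.
  have := cvg_at_right_within (thompsonV_right fV x01).
  apply: cvg_trans; apply: cvg_app; apply: within_subset => y /=.
  by rewrite in_itv /= xu => /andP[].
have nd : ~ discontinuous f x.
  by move=> /hd [|[]]; [lra|lra|exact/eqP].
have : f @ within [set` `[0, 1[] (nbhs x) --> f x.
  by apply: contrapT => h; apply: nd.
apply: cvg_trans; apply: cvg_app; apply: within_subset => y /=.
by rewrite !in_itv /= => /andP[uy yv]; apply/andP; split; lra.
Qed.

Lemma increasing_part n f (u v : R) : dyadic_grid n f ->
  {in `[0, 1[ &, injective f} -> 0 <= u -> v <= 1 ->
  {within `[u, v[, continuous f} ->
  {in `[u, v[ &, {mono f : x y / x < y}}.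
Proof.
move=> gf finj u0 v1 cf.
have [vu|uv] := leP v u.
  by move=> x y; rewrite in_itv /= => /andP[ux xv]; exfalso; lra.
apply: leW_mono_in; apply: itv_continuous_inj_le => //; last first.
  move=> x y; rewrite !in_itv /= => hx hy; apply: finj; rewrite in_itv /=; lra.
have u01 : 0 <= u < 1 by rewrite u0; lra.
have [c [lc /andP[cu uc] c01 c1]] := lev_floor01 n u01.
have [k [b [_ h]]] := gf c lc c01.
pose w := (u + Num.min v (c + 2 ^ (- n%:Z))) / 2.
have uw : u < w.
  by rewrite /w; case: (leP v (c + 2 ^ (- n%:Z))) => ?; lra.
have wv : w < v.
  by rewrite /w; case: (leP v (c + 2 ^ (- n%:Z))) => ?; lra.
have wc : w < c + 2 ^ (- n%:Z).
  by rewrite /w; case: (leP v (c + 2 ^ (- n%:Z))) => ?; lra.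
exists u, w; split; rewrite ?in_itv /= ?lexx ?uv ?wv ?(ltW uw)//.
rewrite !h; [|lra|lra].
by rewrite lerD2r ler_pM2l ?exp2_gt0// ltW.
Qed.

Lemma thompsonT_cyclic n f : maps01 f -> {in `[0, 1[ &, injective f} ->
  set_surj `[0, 1[ `[0, 1[ f -> dyadic_grid n f -> is_thompsonT f ->
  preserves_cyclic f.
Proof.
move=> f01 finj fsurj gf [fV sd].
have finj' x y : 0 <= x < 1 -> 0 <= y < 1 -> f x = f y -> x = y.
  by move=> hx hy; apply: finj; rewrite in_itv.
have [p [p01 hp]] : exists p, 0 <= p < 1 /\ forall x, discontinuous f x -> x = p.
  have [[p dp]|nd] := pselect (exists p, discontinuous f p).
    exists p; split; last by move=> x dx; exact: sd.
    by case: dp => /=; rewrite in_itv.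
  by exists 0; split; [lra|move=> x dx; exfalso; apply: nd; exists x].
have /andP[p0 p1] := p01.
have cL : {within `[0, p[, continuous f}.
  apply: continuous_part => //; first by lra.
  by move=> x /hp ->; lra.
have cR : {within `[p, 1[, continuous f}.
  by apply: continuous_part => // x /hp ->; lra.
have mL : {in `[0, p[ &, {mono f : x y / x < y}}.
  by apply: increasing_part gf finj _ _ cL; lra.
have mR : {in `[p, 1[ &, {mono f : x y / x < y}}.
  by apply: increasing_part gf finj _ _ cR; lra.
have iL x y : 0 <= x -> x < y -> y < p -> f x < f y.
  by move=> x0 xy yp; rewrite mL// in_itv /=; lra.
have iR x y : p <= x -> x < y -> y < 1 -> f x < f y.
  by move=> x0 xy yp; rewrite mR// in_itv /=; lra.
have [|q] := fsurj 0; first by rewrite /= in_itv /=; lra.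
rewrite /= in_itv /= => q01 fq.
have [qp|pq] := ltP q p.
  have f0 : f 0 = 0.
    have [q0|q0] := eqVneq q 0; first by rewrite -{1}q0.
    have := iL 0 q (lexx _); have := f01 0; lra.
  have LR x : 0 <= x -> x < p -> f x < f p.
    move=> x0 xp; rewrite ltNge; apply/negP => fpx.
    have [||c] := @IVT _ f 0 x (f p) x0 _ _.
    - apply: continuous_subspaceW cL => y /=; rewrite !in_itv /=; lra.
    - have /andP[fp0 _] := f01 _ p01.
      by rewrite f0 ge_min le_max fp0 fpx orbT.
    rewrite in_itv /= => cx /finj' e.
    by have : c = p; [apply: e; lra|lra].
  have inc x y : 0 <= x -> x < y -> y < 1 -> f x < f y.
    move=> x0 xy y1; have [yp|py] := ltP y p; first exact: iL.
    have [xp|px] := ltP x p; last exact: iR.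
    apply: lt_le_trans (LR _ x0 xp) _.
    move: py; rewrite le_eqVlt => /orP[/eqP <- //|py].
    by apply/ltW/iR.
  apply: cyclic_wlog => x y z x0 xy yz z1.
  apply/or3P; apply: Or31; apply/andP; split; apply: inc; lra.
have fp : f p = 0.
  move: pq; rewrite le_eqVlt => /orP[/eqP -> //|pq].
  by have := iR p q (lexx _) pq; have := f01 p p01; lra.
have RL x z : 0 <= x -> x < p -> p <= z -> z < 1 -> f z < f x.
  move=> x0 xp pz z1; rewrite ltNge; apply/negP => fxz.
  have [||c] := @IVT _ f p z (f x) pz _ _.
  - apply: continuous_subspaceW cR => y /=; rewrite !in_itv /=; lra.
  - have /f01/andP[fx0 _] : 0 <= x < 1 by lra.
    by rewrite fp ge_min le_max fx0 fxz orbT.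
  rewrite in_itv /= => cx /finj' e.
  by have : c = x; [apply: e; lra|lra].
apply: cyclic_wlog => x y z x0 xy yz z1.
rewrite /cyclic.
have [zp|pz] := ltP z p.
  by rewrite (iL x y) ?(iL y z)//; lra.
have [yp|py] := ltP y p.
  by rewrite (iL x y) ?(RL x z) ?orbT//; lra.
have [xp|px] := ltP x p.
  by rewrite (iR y z) ?(RL x z) ?orbT//; lra.
by rewrite (iR x y) ?(iR y z)//; lra.
Qed.

Lemma cyclic_thompsonT f : maps01 f -> {in `[0, 1[ &, injective f} ->
  set_surj `[0, 1[ `[0, 1[ f -> is_thompsonV f -> preserves_cyclic f ->
  is_thompsonT f.
Proof.
move=> f01 finj fsurj fV cf; split => //.
have finj' x y : 0 <= x < 1 -> 0 <= y < 1 -> f x = f y -> x = y.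
  by move=> hx hy; apply: finj; rewrite in_itv.
have [|p] := fsurj 0; first by rewrite /= in_itv /=; lra.
rewrite /= in_itv /= => p01 fp.
have ge0 x : 0 <= x < 1 -> 0 <= f x by move=> /f01/andP[].
have iL x y : 0 <= x -> x < y -> y < p -> f x < f y.
  move=> x0 xy yp; have : cyclic (f x) (f y) (f p).
    by apply: cf; rewrite /cyclic; lra.
  by rewrite fp; have := ge0 x; have := ge0 y; rewrite /cyclic; lra.
have iR x y : p <= x -> x < y -> y < 1 -> f x < f y.
  rewrite le_eqVlt => /orP[/eqP <- py y1|px xy y1].
    have y01 : 0 <= y < 1 by lra.
    rewrite fp lt_neqAle ge0 // andbT; apply/eqP => e.
    by have := finj' p y p01 y01; rewrite fp => /(_ e); lra.
  have : cyclic (f p) (f x) (f y) by apply: cf; rewrite /cyclic; lra.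
  by rewrite fp; have := ge0 x; have := ge0 y; rewrite /cyclic; lra.
have RL x z : 0 <= x -> x < p -> p < z -> z < 1 -> f z < f x.
  move=> x0 xp pz z1.
  have : cyclic (f x) (f p) (f z) by apply: cf; rewrite /cyclic; lra.
  by rewrite fp; have := ge0 x; have := ge0 z; rewrite /cyclic; lra.
suff main x : discontinuous f x -> x = p by move=> x y /main -> /main ->.
move=> [/= xI]; have := xI; rewrite in_itv /= => /andP[x0 x1] dx.
apply: contrapT => xp; apply: dx.
move: x0; rewrite le_eqVlt => /orP[/eqP e0|x0].
  have := cvg_at_right_within (thompsonV_right fV xI).
  apply: cvg_trans; apply: cvg_app; apply: within_subset => y /=.
  by rewrite in_itv /= -e0 => /andP[].
suff [a [b [a0 ax xb b1 side]]] : exists a b : R, [/\ 0 <= a, a < x, x < b, b < 1 &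
    b < p \/ p < a].
  have ab : a < b by lra.
  have inc u v : a <= u -> u < v -> v <= b -> f u < f v.
    by move=> au uv vb; case: side => ?; [apply: iL|apply: iR]; lra.
  have incm : {in `[a, b] &, {mono f : u v / u <= v}}.
    apply: le_mono_in => u v; rewrite !in_itv /= => /andP[au ub] /andP[av vb] uv.
    exact: inc.
  have cfx : {for x, continuous f}.
    apply: (within_continuous_continuous ab); last by rewrite in_itv /= ax xb.
    apply: segment_inc_surj_continuous => // y /=; rewrite in_itv /= => /andP[fay yfb].
    have y01 : 0 <= y < 1.
      by have := f01 a; have := f01 b; lra.
    have [|z] := fsurj y; first by rewrite /= in_itv.
    rewrite /= in_itv /= => /andP[z0 z1] fzy; exists z => //=.
    rewrite in_itv /=; apply/andP; split; rewrite leNgt; apply/negP => h.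
      case: side => sd; first by have := iL z a z0 h; lra.
      have [zp|pz] := ltP z p; last by have := iR z a pz h; lra.
      by have := RL z b z0 zp; lra.
    case: side => sd; last by have := iR b z; lra.
    have [zp|pz] := ltP z p; first by have := iL b z; lra.
    move: pz; rewrite le_eqVlt => /orP[/eqP pz|pz]; last by have := RL a z; lra.
    have fa0 : f a = 0.
      by have := ge0 a; rewrite -pz fp in fzy; lra.
    by have := finj' a p; rewrite fa0 fp => /(_ _ p01 erefl); lra.
  by apply: cvg_trans cfx; apply: cvg_app; exact: cvg_within.
have [px|xp'] := ltP p x.
  by exists ((p + x) / 2), ((x + 1) / 2); split; lra.
have {}xp' : x < p by rewrite lt_neqAle xp' andbT; apply/eqP.
by exists (x / 2), ((x + p) / 2); split; lra.
Qed.

Lemma cyclic_inv f g : maps01 g -> (forall x, f (g x) = x) ->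
  preserves_cyclic f -> preserves_cyclic g.
Proof.
move=> g01 gK cf x y z x01 y01 z01 cxyz.
have gx := g01 x x01; have gy := g01 y y01; have gz := g01 z z01.
have nxy : g x <> g y by move=> e; have := gK x; rewrite e gK; move: cxyz; rewrite /cyclic; lra.
have nyz : g y <> g z by move=> e; have := gK y; rewrite e gK; move: cxyz; rewrite /cyclic; lra.
have nxz : g x <> g z by move=> e; have := gK x; rewrite e gK; move: cxyz; rewrite /cyclic; lra.
have [//|c] : cyclic (g x) (g y) (g z) \/ cyclic (g x) (g z) (g y).
  rewrite /cyclic; case: (ltgtP (g x) (g y)) => // h1;
  case: (ltgtP (g y) (g z)) => // h2; case: (ltgtP (g x) (g z)) => // h3;
  by [left|right|exfalso; lra].
by have := cf _ _ _ gx gz gy c; rewrite !gK; move: cxyz; rewrite /cyclic; lra.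
Qed.

Section Permutations.
Variables (f : permutation R).
Hypothesis fout : forall x, x \notin `[0, 1[ -> f x = x.

Lemma perm_maps01 : maps01 f.
Proof.
move=> x x01; rewrite -[_ && _]/(f x \in `[0, 1[).
have [//|h] := boolP (f x \in `[0, 1[).
by have /perm_inj e := fout h; move: h; rewrite e in_itv /= x01.
Qed.

Lemma perm_inj01 : {in `[0, 1[ &, injective f}.
Proof. by move=> x y _ _; exact: perm_inj. Qed.

Lemma perm_inv_out x : x \notin `[0, 1[ -> perm_inv f x = x.
Proof. by move=> h; rewrite -{1}(fout h); exact: perm_funK. Qed.

End Permutations.

Lemma perm_surj01 (f : permutation R) :
  (forall x, x \notin `[0, 1[ -> f x = x) -> set_surj `[0, 1[ `[0, 1[ f.
Proof.
move=> fout y y01; exists (perm_inv f y); last exact: perm_inv_funK.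
exact: (perm_maps01 (perm_inv_out fout)).
Qed.

Lemma in_thompsonV_group : group_closed in_thompsonV.
Proof.
split=> [|f g /asboolP fV /asboolP gV]; apply/asboolP.
  by apply: (grid_thompsonV (n := 0) (f := id)) => //; exact: grid_one.
have fout := thompsonV_out fV; have gout := thompsonV_out gV.
have [n hf] := thompsonV_grid (perm_maps01 fout) (@perm_inj01 f)
  (perm_surj01 fout) fV.
have [m hg] := thompsonV_grid (perm_maps01 gout) (@perm_inj01 g)
  (perm_surj01 gout) gV.
have g'01 := perm_maps01 (perm_inv_out gout).
have [p hp] := grid_inv g'01 (perm_funK g) (perm_inv_funK g) hg.
have [q hq] := grid_comp g'01 hp hf.
apply: (grid_thompsonV _ hq) => x xout.
by rewrite -[LHS]/(f (perm_inv g x)) perm_inv_out// fout.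
Qed.

Lemma in_thompsonT_cyclic (f : permutation R) :
  in_thompsonT f <-> in_thompsonV f /\ preserves_cyclic f.
Proof.
have H := fun out => (perm_maps01 (f := f) out, perm_surj01 out).
split=> [/asboolP fT|[/asboolP fV cf]].
  have fV := fT.1; have [f01 fs] := H (thompsonV_out fV).
  split; first exact/asboolP.
  have [n hf] := thompsonV_grid f01 (@perm_inj01 f) fs fV.
  exact: (thompsonT_cyclic f01 (@perm_inj01 f) fs hf fT).
have [f01 fs] := H (thompsonV_out fV).
apply/asboolP; exact: (cyclic_thompsonT f01 (@perm_inj01 f) fs fV cf).
Qed.

Lemma in_thompsonT_group : group_closed in_thompsonT.
Proof.
have [V1 VM] := in_thompsonV_group.
split=> [|f g fT gT].
  by apply/in_thompsonT_cyclic; split; [exact: V1|move=> x y z _ _ _].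
have /in_thompsonT_cyclic[fV cf] : in_thompsonT f by [].
have /in_thompsonT_cyclic[gV cg] : in_thompsonT g by [].
apply/in_thompsonT_cyclic; split; first exact: VM.
have gout : forall x, x \notin `[0, 1[ -> g x = x.
  by move/asboolP: gV => /thompsonV_out.
have g'01 := perm_maps01 (perm_inv_out gout).
have cg' := cyclic_inv g'01 (perm_inv_funK g) cg.
move=> x y z x01 y01 z01 c.
by apply: cf; [exact: g'01|exact: g'01|exact: g'01|exact: cg'].
Qed.

Lemma in_thompsonF_group : group_closed in_thompsonF.
Proof.
have [T1 TM] := in_thompsonT_group.
split=> [|f g /asboolP[fT f0] /asboolP[gT g0]]; apply/asboolP.
  by split=> //; apply/asboolP.
split; last first.
  rewrite -[LHS]/(f (perm_inv g 0)) -[X in perm_inv g X]g0.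
  by rewrite -[perm_inv g _]/(perm_inv_fun g _) perm_funK.
by apply/asboolP; apply: (TM f g); apply/asboolP.
Qed.

End Thompson.

Record thompsonV (R : realType) := ThompsonV {
  thompsonV_val : permutation R; _ : in_thompsonV thompsonV_val }.
HB.instance Definition _ (R : realType) := [isSub for @thompsonV_val R].
HB.instance Definition _ (R : realType) := [Choice of thompsonV R by <:].
HB.instance Definition _ (R : realType) :=
  SubChoice_isSubGroup.Build (permutation R) (@in_thompsonV R) (thompsonV R)
    (@in_thompsonV_group R).

Record thompsonT (R : realType) := ThompsonT {
  thompsonT_val : permutation R; _ : in_thompsonT thompsonT_val }.
HB.instance Definition _ (R : realType) := [isSub for @thompsonT_val R].
HB.instance Definition _ (R : realType) := [Choice of thompsonT R by <:].
HB.instance Definition _ (R : realType) :=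
  SubChoice_isSubGroup.Build (permutation R) (@in_thompsonT R) (thompsonT R)
    (@in_thompsonT_group R).

Record thompsonF (R : realType) := ThompsonF {
  thompsonF_val : permutation R; _ : in_thompsonF thompsonF_val }.
HB.instance Definition _ (R : realType) := [isSub for @thompsonF_val R].
HB.instance Definition _ (R : realType) := [Choice of thompsonF R by <:].
HB.instance Definition _ (R : realType) :=
  SubChoice_isSubGroup.Build (permutation R) (@in_thompsonF R) (thompsonF R)
    (@in_thompsonF_group R).

Section Exactness.
Variables (R : realType) (G : groupType).

Definition l1norm (u : G -> R) : \bar R := \esum_(g in [set: G]) `|u g|%:E.

(* The elements of Prob(G), seen as a subset of l^1(G). *)
Definition probability_vector (p : G -> R) :=
  (forall g, 0 <= p g) /\ \esum_(g in [set: G]) (p g)%:E = 1%E.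

Definition translate (s : G) (u : G -> R) : G -> R :=
  fun g => u (s^-1 * g)%g.

Definition continuous_action (X : topologicalType) (act : G -> X -> X) :=
  [/\ forall x, act 1%g x = x,
      forall s t x, act (s * t)%g x = act s (act t x) &
      forall s, continuous (act s)].

(* There is a net of continuous maps m_i : X -> Prob(G) such that, for every s,
   sup_x || s.m_i(x) - m_i(s.x) ||_1 tends to 0. The net is indexed by a type I
   with a proper filter F (for a directed set, the filter of its tails), and
   Prob(G) carries the weak-* topology, which on Prob(G) is the topology of
   pointwise convergence on G (and also the one of the l^1 norm). *)
Definition topologically_amenable (X : topologicalType) (act : G -> X -> X) :=
  exists (I : Type) (F : set_system I) (m : I -> X -> G -> R),
  [/\ ProperFilter F,
      forall i x, probability_vector (m i x),
      forall i g, continuous (fun x => m i x g) &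
      forall s,
        ereal_sup [set l1norm (translate s (m i x) \- m i (act s x))
                  | x in [set: X]] @[i --> F] --> 0%E].

(* X has to be nonempty: every action on the empty space would qualify. *)
Definition exact_group := exists (X : topologicalType) (act : G -> X -> X),
  [/\ compact [set: X], hausdorff_space X, [set: X] !=set0,
      continuous_action act & topologically_amenable act].

End Exactness.

(* Main.v *)
Require Import Defs.
From mathcomp Require Import all_boot all_order all_algebra.
From mathcomp Require Import all_classical all_reals all_analysis.
From mathcomp Require Import lra zify.

(** Exactness is compared with a combinatorial condition, property A: for every
    finite E in G and e > 0 there are finitely supported probability vectors
    mu(t), one for each t in G and all carried by one finite set, such that
    s.mu(t) and mu(s t) are e-close in l^1-norm for s in E and all t.

    Exact groups have property A ([exact_property_A]): take the maps
    m : X -> Prob(G) of an amenable action, restrict them to one orbit, and use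
    compactness of X to truncate all m(x) to one finite set. Conversely
    ([property_A_exact]), the families mu with given supports and tolerances
    form a closed subset of a product of intervals, hence a compact space, and
    G acts on it by right translation of the argument t; the evaluations
    mu |-> mu(1) witness that this action is amenable.

    Property A passes to a subgroup H of G by means of an H-equivariant
    retraction G -> H ([property_A_subgroup]), which settles the implication
    from T to F. For the other one, property A also passes up from H to G as
    soon as the G-set G/H itself carries almost equivariant, uniformly finitely
    supported probability vectors ([property_A_extension]): choose a coset
    almost equivariantly, then a point of that coset by property A of H.

    For H = F and G = T, the set G/H is the orbit of 0, that is, the set of
    dyadic points of the circle. To t in T attach the uniform measure on the
    truncations of the binary expansion of t(0) to N, N+1, ..., N+n-1 digits.
    An element s of T is affine with slope 2^l near a point x, so, once N is
    large, it maps the truncation of x to k digits to the truncation of s(x) to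
    k - l digits. As l is bounded in terms of s only, applying s to the measure
    attached to t gives, up to an error O(1/n), the measure attached to s t
    ([thompsonT_relative_property_A]). *)

Set Implicit Arguments.
Unset Strict Implicit.
Unset Printing Implicit Defensive.

Import Order.TTheory GRing.Theory Num.Theory.
Import numFieldNormedType.Exports.

Local Open Scope classical_set_scope.
Local Open Scope ring_scope.

(** * Property A, its heredity and its extension *)

Section PropertyA.
Variable R : realType.

(** Almost equivariant probability vectors on the coset space G/K. A vector is
    a formal convex combination of the points [z t i] with weights [w t i], so
    that images and mixtures of vectors need no bookkeeping of supports. The
    l^1-distance is measured by duality against functions bounded by 1, and a
    function on G/K is a right K-invariant function on G. *)
Definition relative_property_A (G : groupType) (K : set G) :=
  forall (E : seq G) (e : R), 0 < e ->
  exists (I : finType) (w : G -> I -> R) (z : G -> I -> G) (S : seq G),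
  [/\ forall t i, 0 <= w t i, forall t, \sum_i w t i = 1,
      forall t i, z t i \in S &
      forall s t (phi : G -> R), s \in E -> (forall g, `|phi g| <= 1) ->
        (forall g k, K k -> phi (g * k)%g = phi g) ->
        `|\sum_i w t i * phi (s * z t i)%g
          - \sum_i w (s * t)%g i * phi (z (s * t)%g i)| <= e].

Definition property_A (G : groupType) := relative_property_A [set (1%g : G)].

Lemma mean_le (I : finType) (w f : I -> R) (e : R) :
  (forall i, 0 <= w i) -> \sum_i w i = 1 -> (forall i, `|f i| <= e) ->
  `|\sum_i w i * f i| <= e.
Proof.
move=> w0 w1 fe; apply: le_trans (ler_norm_sum _ _ _) _.
rewrite -[leRHS]mul1r -w1 mulr_suml; apply: ler_sum => i _.
by rewrite normrM (ger0_norm (w0 i)) ler_wpM2l.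
Qed.

Section Subgroup.
Variables (G H : groupType) (iota : H -> G).
Hypothesis iotaM : {morph iota : x y / (x * y)%g >-> (x * y)%g}.
Hypothesis iota_inj : injective iota.

(** Left cosets equal as sets have the same representative, because the choice
    made by [xget] depends on the coset only. *)
Definition coset_rep (g : G) : G :=
  xget 1%g [set g' | exists h, g' = (g * iota h)%g].

Lemma iota1 : iota 1%g = 1%g.
Proof. by apply: (@mulIg _ (iota 1%g)); rewrite -iotaM !mul1g. Qed.

Lemma iotaV h : iota (h^-1)%g = ((iota h)^-1)%g.
Proof. by apply: (@mulIg _ (iota h)); rewrite -iotaM !mulVg iota1. Qed.

Lemma coset_repP g : exists h, coset_rep g = (g * iota h)%g.
Proof.
rewrite /coset_rep; case: xgetP => // /(_ g) []; exists 1%g.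
by rewrite iota1 mulg1.
Qed.

Lemma coset_repM g h : coset_rep (g * iota h)%g = coset_rep g.
Proof.
rewrite /coset_rep; congr (xget _ _); apply/seteqP; split=> x [h' ->] /=.
  by exists (h * h')%g; rewrite iotaM mulgA.
by exists (h^-1 * h')%g; rewrite -mulgA -iotaM mulVKg.
Qed.

(** The element g = x r with x in H and r the inverse of the representative of
    the left coset of g^-1 is sent to x; r is constant on the right coset H g,
    which makes the map left H-equivariant. *)
Definition retraction (g : G) : H :=
  xget 1%g [set h | iota h = (g * coset_rep g^-1)%g].

Lemma retractionP g : iota (retraction g) = (g * coset_rep g^-1)%g.
Proof.
rewrite /retraction; case: xgetP => [h _ //|none].
by have [h e] := coset_repP g^-1; case: (none h); rewrite /= e mulgA mulgV mul1g.
Qed.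

Lemma retractionM h g : retraction (iota h * g)%g = (h * retraction g)%g.
Proof.
apply: iota_inj; rewrite iotaM !retractionP invgM -iotaV coset_repM.
by rewrite mulgA.
Qed.

(** The vectors of G at the points of H are pushed to H by the equivariant
    retraction. *)
Lemma property_A_subgroup : property_A G -> property_A H.
Proof.
move=> GA E e e0.
have [I [w [z [S [w0 w1 zS hz]]]]] := GA (map iota E) e e0.
exists I, (fun t => w (iota t)), (fun t i => retraction (z (iota t) i)).
exists (map retraction S); split=> // [t i|s t phi sE phi1 _].
  exact: map_f.
have := hz (iota s) (iota t) (phi \o retraction) (map_f _ sE) (fun=> phi1 _).
rewrite -iotaM /=; under eq_bigr do rewrite retractionM.
by apply=> g k ->; rewrite mulg1.
Qed.

(** A vector at t is drawn in two steps: a coset d by the relative vectors, then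
    a point of d by transporting to d a vector of H through [coset_rep d].
    Moving by s changes the second step by the cocycle
    [(coset_rep (s d))^-1 s (coset_rep d)], which lies in H and takes finitely
    many values for s in E and d in the common support; property A of H is
    applied to those values. *)
Lemma property_A_extension :
  relative_property_A (range iota) -> property_A H -> property_A G.
Proof.
move=> GA HA E e e0.
have e20 : 0 < e / 2 by rewrite divr_gt0.
have [I [w [z [S [w0 w1 zS hz]]]]] := GA E _ e20.
pose cocycle s d : H := xget 1%g
  [set c | iota c = ((coset_rep (s * d))^-1 * (s * coset_rep d))%g].
have cocycleP s d :
    (s * coset_rep d)%g = (coset_rep (s * d) * iota (cocycle s d))%g.
  rewrite /cocycle; case: xgetP => [c _ /= ->|none].
    by rewrite mulgA mulgV mul1g.
  have [h e1] := coset_repP (s * d); have [h' e2] := coset_repP d.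
  case: (none (h^-1 * h')%g) => /=.
  by rewrite e1 e2 iotaM iotaV [(s * (d * _))%g]mulgA invgM -[RHS]mulgA mulKg.
(* The relative vectors are chosen first: the finite set for H depends on
   their support. *)
have [J [v [y [S' [v0 v1 yS hy]]]]] :=
  HA [seq cocycle s d | s <- E, d <- S] _ e20.
(* The argument at which the vector of H on the coset d is taken, seen from t. *)
pose b t d := retraction ((coset_rep d)^-1 * t)%g.
exists (I * J)%type, (fun t ij => w t ij.1 * v (b t (z t ij.1)) ij.2).
exists (fun t ij => (coset_rep (z t ij.1) * iota (y (b t (z t ij.1)) ij.2))%g).
exists [seq (coset_rep d * iota h)%g | d <- S, h <- S']; split.
- by move=> t ij; exact: mulr_ge0.
- move=> t; rewrite -(pair_bigA _ (fun i j => w t i * v (b t (z t i)) j)) /=.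
  by under eq_bigr do rewrite -mulr_sumr v1 mulr1.
- move=> t ij; apply/allpairsP.
  by exists (z t ij.1, y (b t (z t ij.1)) ij.2); split=> /=.
move=> s t phi sE phi1 _.
(* Conditional expectation of phi given the coset of g; it is right H-invariant
   because g enters through its representative only. *)
pose Phi t g := \sum_j v (b t g) j * phi (coset_rep g * iota (y (b t g) j))%g.
have sumE t' psi : \sum_(ij : I * J) w t' ij.1 * v (b t' (z t' ij.1)) ij.2 *
      phi (psi (coset_rep (z t' ij.1) * iota (y (b t' (z t' ij.1)) ij.2))%g) =
    \sum_i w t' i * \sum_j v (b t' (z t' i)) j *
      phi (psi (coset_rep (z t' i) * iota (y (b t' (z t' i)) j))%g).
  rewrite -(pair_bigA _ (fun i j => w t' i * v (b t' (z t' i)) j *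
     phi (psi (coset_rep (z t' i) * iota (y (b t' (z t' i)) j))%g))) /=.
  by apply: eq_bigr => i _; rewrite mulr_sumr;
    apply: eq_bigr => j _; rewrite mulrA.
rewrite (sumE t (fun g => (s * g)%g)) (sumE (s * t)%g id).
have -> : e = e / 2 + e / 2 by lra.
apply: le_trans (ler_distD (\sum_i w t i * Phi (s * t)%g (s * z t i)%g) _ _) _.
apply: lerD; last first.
  apply: (hz s t (Phi (s * t)%g)) => // [g|g _ [h _ <-]].
    exact: mean_le.
  by rewrite /Phi /b coset_repM.
rewrite -sumrB; under eq_bigr do rewrite -mulrBr.
apply: mean_le => // i.
rewrite /Phi.
have -> : b (s * t)%g (s * z t i)%g = (cocycle s (z t i) * b t (z t i))%g.
  rewrite /b -retractionM; congr retraction.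
  rewrite [in RHS]mulgA; apply: (@mulgI _ (coset_rep (s * z t i)%g)).
  by rewrite mulVKg [RHS]mulgA [in RHS]mulgA -cocycleP mulgK.
have := hy (cocycle s (z t i)) (b t (z t i))
  (fun h => phi (coset_rep (s * z t i) * iota h)%g).
under eq_bigr do rewrite iotaM mulgA -cocycleP -mulgA.
apply=> // [|g k ->]; last by rewrite mulg1.
by apply/allpairsP; exists (s, z t i); split=> /=.
Qed.

End Subgroup.
End PropertyA.

(** * From exactness to property A *)

Section FiniteSums.
Variables (R : realType) (T : choiceType).
Implicit Types (B C : seq T) (f p : T -> R).

Lemma sum_split B C f : uniq B -> uniq C -> {subset B <= C} ->
  \sum_(g <- C) f g = \sum_(g <- B) f g + \sum_(g <- C | g \notin B) f g.
Proof.
move=> uB uC BC; rewrite (bigID (mem B)) /=; congr (_ + _).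
rewrite -big_filter; apply: perm_big; apply: uniq_perm => //.
  exact: filter_uniq.
by move=> g; rewrite mem_filter andb_idr//; exact: BC.
Qed.

Lemma sum_support B C f : uniq B -> uniq C ->
  (forall g, g \notin B -> f g = 0) -> (forall g, g \notin C -> f g = 0) ->
  \sum_(g <- B) f g = \sum_(g <- C) f g.
Proof.
move=> uB uC fB fC; have U := undup_uniq (B ++ C).
have [sB sC] : {subset B <= undup (B ++ C)} /\ {subset C <= undup (B ++ C)}.
  by split=> g; rewrite mem_undup mem_cat => ->; rewrite ?orbT.
transitivity (\sum_(g <- undup (B ++ C)) f g).
  by rewrite (sum_split f uB U sB) [X in _ + X]big1 ?addr0// => g /fB.
by rewrite (sum_split f uC U sC) [X in _ + X]big1 ?addr0// => g /fC.
Qed.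

Lemma sum_continuous (X : topologicalType) (S : seq T) (f : T -> X -> R) :
  (forall g, continuous (f g)) -> continuous (fun x => \sum_(g <- S) f g x).
Proof.
move=> cf x; apply: (@cvg_big _ _ _ _ _ _ _ (nbhs x) S f (f ^~ x)).
  exact: add_continuous.
by move=> g _; exact: cf.
Qed.

Lemma esum_ge_seq B f : uniq B ->
  ((\sum_(g <- B) f g)%:E <= \esum_(g in [set: T]) (f g)%:E)%E.
Proof.
move=> uB; apply: ereal_sup_ubound; exists [set` B].
  by split=> //; exact: finite_seq.
by rewrite -fsbig_seq// sumEFin.
Qed.

Lemma esum_le_seq f (c : \bar R) :
  (forall B, uniq B -> ((\sum_(g <- B) f g)%:E <= c)%E) ->
  (\esum_(g in [set: T]) (f g)%:E <= c)%E.
Proof.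
move=> h; apply: ge_ereal_sup => _ [A [finA _] <-].
by rewrite fsbig_finite//= sumEFin; apply: h; exact: finmap.fset_uniq.
Qed.

End FiniteSums.

Section ProbabilityVectors.
Variables (R : realType) (G : groupType).
Implicit Types (B C : seq G) (p phi : G -> R).

Lemma probability_sum_le1 B p : probability_vector p -> uniq B ->
  \sum_(g <- B) p g <= 1.
Proof. by move=> [_ p1] uB; rewrite -lee_fin -p1; exact: esum_ge_seq. Qed.

Lemma probability_sum_gt p (e : R) : probability_vector p -> 0 < e ->
  exists2 B, uniq B & 1 - e < \sum_(g <- B) p g.
Proof.
move=> [_ p1] e0; apply: contrapT => h.
have : (\esum_(g in [set: G]) (p g)%:E <= (1 - e)%:E)%E.
  apply: esum_le_seq => B uB; rewrite lee_fin leNgt; apply/negP => hB.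
  by apply: h; exists B.
by rewrite p1 lee_fin; lra.
Qed.

(** Once B carries mass more than 1 - e, enlarging B changes the expectation of
    a function bounded by 1 by at most the mass left outside B. *)
Lemma probability_tail B C p phi (e : R) : probability_vector p ->
  uniq B -> uniq C -> {subset B <= C} -> 1 - e < \sum_(g <- B) p g ->
  (forall g, `|phi g| <= 1) ->
  `|\sum_(g <- C) p g * phi g - \sum_(g <- B) p g * phi g| <= e.
Proof.
move=> pp uB uC BC pB phi1.
rewrite (sum_split _ uB uC BC) addrAC subrr add0r.
have := probability_sum_le1 pp uC; rewrite (sum_split _ uB uC BC) => pC.
apply: le_trans (ler_norm_sum _ _ _) _.
apply: le_trans (_ : \sum_(g <- C | g \notin B) p g <= _); last by lra.
by apply: ler_sum => g _; rewrite normrM ger0_norm ?pp.1// ler_piMr// pp.1.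
Qed.

(** Each m x has a finite set of mass more than 1 - e; by continuity the same set
    works near x, and any larger one does too, so compactness yields one set
    for all x. *)
Lemma uniform_tightness (X : topologicalType) (m : X -> G -> R) (e : R) :
  compact [set: X] -> (forall x, probability_vector (m x)) ->
  (forall g, continuous (fun x => m x g)) -> 0 < e ->
  exists2 B, uniq B & forall x, 1 - e < \sum_(g <- B) m x g.
Proof.
move=> cX mp mc e0.
pose U B := [set x | 1 - e < \sum_(g <- B) m x g].
have oU B : open (U B).
  apply: open_comp (@open_gt R (1 - e)) => x _.
  exact: (sum_continuous (f := fun g x => m x g) mc).
pose F := filter_from [set B0 : seq G | uniq B0]
  (fun B0 => [set B | uniq B /\ {subset B0 <= B}]).
have FF : Filter F.
  apply: filter_from_filter; first by exists [::].
  move=> B B' _ _; exists (undup (B ++ B')); first exact: undup_uniq.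
  by move=> C [uC sC]; split; split=> // g gB; apply: sC;
    rewrite mem_undup mem_cat gB ?orbT.
have [x _|B0 uB0 hB0] := (compact_near_coveringP _).1 cX _ F (fun B => U B) FF.
  have [B0 uB0 xB0] := probability_sum_gt (mp x) e0.
  exists (U B0, [set B | uniq B /\ {subset B0 <= B}]).
    by split; [apply: open_nbhs_nbhs; split=> //; exact: oU|exists B0].
  move=> [x' B] /= [x'B0 [uB sB]]; apply: lt_le_trans x'B0 _.
  by rewrite (sum_split _ uB0 uB sB) lerDl sumr_ge0// => g _; exact: (mp x').1.
by exists B0 => // x; exact: (hB0 B0 (conj uB0 (fun _ => id)) x Logic.I).
Qed.

(** The vector at t is m(t x0) truncated to a finite set B that is almost full
    for all points of X; the missing mass is put on 1. *)
Lemma exact_property_A : exact_group R G -> property_A R G.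
Proof.
move=> [X [act [cX _ [x0 _] [act1 actM actc] [I [F [m [PF mp mc mF]]]]]]] E e e0.
(* Five errors add up: the defect of equivariance of m, and for each of the two
   vectors the mass moved to 1 and the tail outside B. *)
pose d := e / 5; have d0 : 0 < d by rewrite divr_gt0.
have [i hi] : exists i, forall s, s \in E -> forall x,
    (l1norm (translate s (m i x) \- m i (act s x))%R <= d%:E)%E.
  suff /filter_ex : F [set i | forall s, s \in E -> forall x,
    (l1norm (translate s (m i x) \- m i (act s x))%R <= d%:E)%E] by [].
  elim: E => [|s E IH]; first by apply: filterS filterT => i _ s.
  have : F [set i | (ereal_sup [set l1norm (translate s (m i x) \- m i (act s x))%R
                  | x in [set: X]] < d%:E)%E].
    have /(mF s) : nbhs (0%E : \bar R) [set y | (y < d%:E)%E].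
      by apply: open_ereal_lt'; rewrite lte_fin.
    exact.
  apply: filterS2 IH => i IH hs s'; rewrite in_cons => /orP[/eqP ->|/IH//] x.
  apply: le_trans (ltW hs); apply: ereal_sup_ubound; by exists x.
have [B uB hB] := uniform_tightness cX (mp i) (mc i) d0.
pose p t := m i (act t x0).
have pp t : probability_vector (p t) by exact: mp.
(* The index 0 carries the missing mass, the others enumerate B. *)
pose w t (k : 'I_(size B).+1) :=
  if unlift ord0 k is Some j then p t (nth 1%g B j) else 1 - \sum_(g <- B) p t g.
pose z (t : G) (k : 'I_(size B).+1) :=
  if unlift ord0 k is Some j then nth 1%g B j else 1%g.
have wz t t' psi : \sum_k w t k * psi (z t' k) =
    (1 - \sum_(g <- B) p t g) * psi 1%g + \sum_(g <- B) p t g * psi g.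
  rewrite big_ord_recl /w /z unlift_none; congr (_ + _).
  rewrite [RHS](big_nth 1%g) big_mkord.
  by apply: eq_bigr => k _; rewrite liftK.
exists 'I_(size B).+1, w, z, (1%g :: B); split.
- move=> t k; rewrite /w; case: unlift => [j|]; first exact: (pp t).1.
  by rewrite subr_ge0 probability_sum_le1.
- move=> t; transitivity (\sum_k w t k * 1).
    by apply: eq_bigr => k _; rewrite mulr1.
  rewrite (wz t t (fun=> 1)) mulr1 (eq_bigr _ (fun g _ => mulr1 (p t g))); lra.
- move=> t k; rewrite /z; case: unlift => [j|]; last exact: mem_head.
  by rewrite in_cons mem_nth ?orbT.
move=> s t phi sE phi1 _.
rewrite (wz t t (fun g => phi (s * g)%g)) wz mulg1.
(* C contains B and s B, so that it is almost full for both m(s t x0) and the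
   translate by s of m(t x0). *)
pose C := undup (map (fun g => s * g)%g B ++ B).
have uC : uniq C by exact: undup_uniq.
have uC' : uniq (map (fun g => s^-1 * g)%g C).
  by rewrite map_inj_uniq//; exact: mulgI.
have BC : {subset B <= C} by move=> g; rewrite mem_undup mem_cat => ->; rewrite orbT.
have BC' : {subset B <= map (fun g => s^-1 * g)%g C}.
  move=> g gB; apply/mapP; exists (s * g)%g; last by rewrite mulKg.
  by rewrite mem_undup mem_cat map_f.
have h1 := probability_tail (pp t) uB uC' BC' (hB _) (fun g => phi1 (s * g)%g).
have h2 := probability_tail (pp (s * t)%g) uB uC BC (hB _) phi1.
have h3 : `|\sum_(g <- map (fun g => s^-1 * g)%g C) p t g * phi (s * g)%g
    - \sum_(g <- C) p (s * t)%g g * phi g| <= d.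
  rewrite big_map -sumrB.
  apply: le_trans (ler_norm_sum _ _ _) _.
  rewrite -lee_fin; apply: le_trans (hi s sE (act t x0)).
  apply: le_trans (esum_ge_seq _ uC); rewrite lee_fin; apply: ler_sum => g _.
  rewrite mulVKg -mulrBl normrM /p actM /translate /=.
  exact: ler_piMr.
have h4 u g : `|(1 - \sum_(g <- B) p u g) * phi g| <= d.
  have := hB (act u x0); have := probability_sum_le1 (pp u) uB; rewrite /p => a b.
  rewrite normrM ger0_norm; last by lra.
  apply: le_trans (ler_piMr _ (phi1 g)) _; lra.
have := h4 t s; have := h4 (s * t)%g 1%g; move: h1 h2 h3.
rewrite !ler_norml /d; lra.
Qed.

End ProbabilityVectors.

(** * From property A to exactness *)

Section ClosedSubsets.
Variable Y : topologicalType.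

Lemma closed_forall (J : Type) (P : J -> Y -> Prop) :
  (forall j, closed [set y | P j y]) -> closed [set y | forall j, P j y].
Proof.
move=> cP; have -> : [set y | forall j, P j y] = \bigcap_j [set y | P j y].
  by apply/seteqP; split=> y /= h j; [move=> _; exact: h|exact: (h j Logic.I)].
by apply: closed_bigI => j _; exact: cP.
Qed.

Lemma closed_eqr (R : realType) (f : Y -> R) c :
  continuous f -> closed [set y | f y = c].
Proof. by move=> cf; apply: preimage_closed (@closed_eq R c) => y _; exact: cf. Qed.

Lemma closed_ler (R : realType) (f : Y -> R) c :
  continuous f -> closed [set y | f y <= c].
Proof. by move=> cf; apply: preimage_closed (@closed_le R c) => y _; exact: cf. Qed.

Variable A : set Y.

Lemma val_cvg (x : A) : set_val @ x --> set_val x.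
Proof. exact: initial_continuous. Qed.

Lemma hausdorff_subtype : hausdorff_space Y -> hausdorff_space A.
Proof.
move=> hY x y xy; apply: val_inj; apply: hY => U V xU yV.
have [u [uU uV]] := xy _ _ (@val_cvg x _ xU) (@val_cvg y _ yV).
by exists (set_val u).
Qed.

Lemma compact_subtype : compact A -> compact [set: A].
Proof.
move=> cA F PF _.
have [|a [Aa Fa]] := cA (set_val @ F) _.
  by apply: (@filterS _ F _ setT) => // [x _|]; [exact: set_valP|exact: filterT].
exists (exist _ a (mem_set Aa)); split=> // U V FU [_ [[W oW <-] Wa] WV].
have FW : (set_val @ F) (set_val @` U).
  by apply: (@filterS _ F _ U) => // u Uu; exists u.
have [_ [[u Uu <-] Wu]] := Fa _ W FW (open_nbhs_nbhs (conj oW Wa)).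
by exists u; split=> //; exact: WV.
Qed.

Lemma continuous_subtype (X : topologicalType) (f : X -> A) :
  continuous (set_val \o f) -> continuous f.
Proof. exact: continuous_comp_initial. Qed.

End ClosedSubsets.

Section Compactification.
Variables (R : realType) (G : groupType).

(** The formal convex combinations of property A, collected into functions on G
    by adding the weights of equal points. *)
Lemma property_A_vectors (E : seq G) (e : R) : property_A R G -> 0 < e ->
  exists (mu : G -> G -> R) (S : seq G),
  [/\ uniq S, forall t g, 0 <= mu t g, forall t g, g \notin S -> mu t g = 0,
      forall t, \sum_(g <- S) mu t g = 1 &
      forall s t (phi : G -> R), s \in E -> (forall g, `|phi g| <= 1) ->
        `|\sum_(g <- S) mu t g * phi (s * g)%g
          - \sum_(g <- S) mu (s * t)%g g * phi g| <= e].
Proof.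
move=> GA e0; have [I [w [z [S [w0 w1 zS hz]]]]] := GA E e e0.
have sumE t psi : \sum_(g <- undup S) (\sum_(k | z t k == g) w t k) * psi g =
    \sum_k w t k * psi (z t k).
  transitivity (\sum_(g <- undup S) \sum_(k | z t k == g) w t k * psi (z t k)).
    apply: eq_bigr => g _; rewrite mulr_suml; apply: eq_bigr => k /eqP -> //.
  rewrite (exchange_big_dep xpredT)//=; apply: eq_bigr => k _.
  under eq_bigl do rewrite eq_sym.
  rewrite -big_filter (_ : [seq g <- undup S | g == z t k] = [:: z t k]).
    by rewrite big_seq1.
  by apply: filter_pred1_uniq; rewrite ?undup_uniq// mem_undup.
exists (fun t g => \sum_(k | z t k == g) w t k), (undup S); split.
- exact: undup_uniq.
- by move=> t g; apply: sumr_ge0.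
- move=> t g; rewrite mem_undup => gS; apply: big1 => k /eqP kg.
  by move: gS; rewrite -kg zS.
- move=> t; rewrite -(w1 t); have := sumE t (fun=> 1).
  by under eq_bigr do rewrite mulr1; move=> ->;
    apply: eq_bigr => k _; rewrite mulr1.
move=> s t phi sE phi1; rewrite (sumE t (fun g => phi (s * g)%g)) sumE.
by apply: hz => // g _ ->; rewrite mulg1.
Qed.

(** A point of [Y] is a family of functions on G indexed by t in G and by a pair
    i of a finite subset of G and a natural number encoding a tolerance. *)
Let Y := {ptws (G * (seq G * nat) * G) -> R}.

Definition tolerance (i : seq G * nat) : R := i.2.+1%:R^-1.

(** The families that satisfy the conclusions of [property_A_vectors] with
    prescribed supports; all the conditions are closed and each involves
    finitely many coordinates. *)
Definition admissible (S : seq G * nat -> seq G) : set Y :=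
  [set y | [/\ forall k, 0 <= y k, forall k, y k <= 1,
    forall t i, \sum_(g <- S i) y (t, i, g) = 1,
    forall t i g, g \notin S i -> y (t, i, g) = 0 &
    forall (i : seq G * nat) s t (phi : G -> R), s \in i.1 ->
      (forall g, `|phi g| <= 1) ->
      `|\sum_(g <- S i) y (t, i, g) * phi (s * g)%g
        - \sum_(g <- S i) y ((s * t)%g, i, g) * phi g| <= tolerance i]].

Lemma coordinate_continuous k : continuous (fun y : Y => y k).
Proof. exact: (@proj_continuous _ (fun=> R) k). Qed.

Lemma coordinates_continuous (X : topologicalType) (f : X -> Y) :
  (forall k, continuous (fun x => f x k)) -> continuous f.
Proof.
move=> cf x; apply/cvg_sup => k.
by apply: (@continuous_comp_initial _ _ _ (fun y : Y => y k)) => x'; exact: cf.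
Qed.

Lemma closed_admissible S : closed (admissible S).
Proof.
have -> : admissible S =
    [set y : Y | forall k, 0 <= y k] `&` [set y : Y | forall k, y k <= 1] `&`
    [set y : Y | forall t i, \sum_(g <- S i) y (t, i, g) = 1] `&`
    [set y : Y | forall t i g, g \notin S i -> y (t, i, g) = 0] `&`
    [set y : Y | forall (i : seq G * nat) s t (phi : G -> R), s \in i.1 ->
      (forall g, `|phi g| <= 1) ->
      `|\sum_(g <- S i) y (t, i, g) * phi (s * g)%g
        - \sum_(g <- S i) y ((s * t)%g, i, g) * phi g| <= tolerance i].
  apply/seteqP; split=> y.
    by move=> [h0 h1 h2 h3 h4]; exact: (conj (conj (conj (conj h0 h1) h2) h3) h4).
  by move=> [[[[h0 h1] h2] h3] h4]; exact: And5 h0 h1 h2 h3 h4.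
have cs t i psi : continuous (fun y : Y => \sum_(g <- S i) y (t, i, g) * psi g).
  apply: (@sum_continuous _ _ Y (S i) (fun g y => y (t, i, g) * psi g)) => g y.
  apply: (@continuous_comp Y R R (fun y => y (t, i, g)) ( *%R^~ (psi g))).
    exact: coordinate_continuous.
  exact: mulrr_continuous.
repeat apply: closedI.
- apply: closed_forall => k.
  by apply: preimage_closed (@closed_ge R 0) => y _; exact: coordinate_continuous.
- by apply: closed_forall => k; apply: closed_ler; exact: coordinate_continuous.
- do 2 apply: closed_forall => ?; apply: closed_eqr.
  apply: (@sum_continuous _ _ Y _ (fun g y => y (_, _, g))) => g.
  exact: coordinate_continuous.
- do 4 apply: closed_forall => ?; apply: closed_eqr; exact: coordinate_continuous.
apply: closed_forall => i; apply: closed_forall => s; apply: closed_forall => t.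
apply: closed_forall => phi; do 2 apply: closed_forall => _.
apply: closed_ler => y.
exact: (cvg_norm (cvgB (cs t i (fun g => phi (s * g)%g) y)
  (cs (s * t)%g i phi y))).
Qed.

Lemma compact_admissible S : compact (admissible S).
Proof.
have cY : compact [set y : Y | forall k, `[0, 1]%classic (y k)].
  exact: (@tychonoff _ (fun=> R) (fun=> `[0, 1]%classic)
    (fun=> @segment_compact R 0 1)).
apply: (subclosed_compact (@closed_admissible S) cY) => y [y0 y1 _ _ _] k.
by rewrite /= in_itv /= y0 y1.
Qed.

(** Equivariance compares the arguments t and s t, so it survives translation of
    t on the right, which is a left action. *)
Definition right_translate (s : G) (y : Y) : Y :=
  fun k => y ((k.1.1 * s)%g, k.1.2, k.2).

Lemma admissible_translate S s y :
  admissible S y -> admissible S (right_translate s y).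
Proof.
move=> [y0 y1 ysum ysupp yE]; split=> [k|k|t i|t i g gS|i s' t phi sE phi1].
- exact: y0.
- exact: y1.
- exact: (ysum (t * s)%g i).
- exact: (ysupp (t * s)%g i g gS).
by have := yE i s' (t * s)%g phi sE phi1; rewrite mulgA.
Qed.

(** The space of all admissible families is compact, and nonempty by property A.
    For the action by right translation, the evaluation at t = 1 sends s.y to
    the vector of y at s, which is close to the translate by s of the vector of
    y at 1. *)
Lemma property_A_exact : property_A R G -> exact_group R G.
Proof.
move=> GA.
have tol_gt0 i : 0 < tolerance i by rewrite /tolerance invr_gt0 ltr0n.
have /choice[muS hmuS] : forall i : seq G * nat,
    exists muS : (G -> G -> R) * seq G,
  [/\ uniq muS.2, forall t g, 0 <= muS.1 t g, forall t g, g \notin muS.2 -> muS.1 t g = 0,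
      forall t, \sum_(g <- muS.2) muS.1 t g = 1 &
      forall s t (phi : G -> R), s \in i.1 ->
      (forall g, `|phi g| <= 1) ->
        `|\sum_(g <- muS.2) muS.1 t g * phi (s * g)%g
          - \sum_(g <- muS.2) muS.1 (s * t)%g g * phi g| <= tolerance i].
  by move=> i; have [mu [S h]] := property_A_vectors i.1 GA (tol_gt0 i); exists (mu, S).
pose S i := (muS i).2.
have uS i : uniq (S i) by have [] := hmuS i.
pose X := set_type (admissible S) : topologicalType.
pose act s (x : X) : X := exist _ (right_translate s (set_val x))
  (mem_set (admissible_translate s (set_valP x))).
pose base : Y := fun k => (muS k.1.2).1 k.1.1 k.2.
have base_adm : admissible S base.
  split=> [[[t i] g]|[[t i] g]|t i|t i g|i s t phi]; rewrite /base /=;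
    have [u0 h0 hS h1 hE] := hmuS i; [exact: h0| |exact: h1|exact: hS|exact: hE].
  have [gS|/hS -> //] := boolP (g \in S i).
  rewrite -(h1 t) (bigD1_seq g)//= lerDl.
  by apply: sumr_ge0 => g' _; exact: h0.
exists X, act; split.
- exact/compact_subtype/compact_admissible.
- apply: hausdorff_subtype; apply: (@hausdorff_product _ (fun=> R)) => k.
  exact: Rhausdorff.
- by exists (exist _ base (mem_set base_adm)).
- split=> [x|s t x|s].
  + apply: val_inj; apply/funext => -[[u i] g].
    by rewrite -[LHS]/(set_val x ((u * 1)%g, i, g)) mulg1.
  + apply: val_inj; apply/funext => -[[u i] g].
    rewrite -[LHS]/(set_val x ((u * (s * t))%g, i, g)).
    by rewrite -[RHS]/(set_val x ((u * s * t)%g, i, g)) mulgA.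
  + apply: continuous_subtype; apply: coordinates_continuous => k x.
    apply: (@continuous_comp _ _ _ set_val (fun y : Y => y ((k.1.1 * s)%g, k.1.2, k.2))).
      exact: val_cvg.
    exact: coordinate_continuous.
pose m i (x : X) g := set_val x (1%g, i, g).
pose large (j i : seq G * nat) := {subset j.1 <= i.1} /\ (j.2 <= i.2)%N.
exists (seq G * nat)%type, (filter_from setT (fun j => [set i | large j i])), m.
split.
- apply: filter_from_proper; last by move=> j _; exists j; split.
  apply: filter_from_filter; first by exists ([::], 0%N).
  move=> j j' _ _; exists (j.1 ++ j'.1, maxn j.2 j'.2) => // i [/= ji].
  rewrite geq_max => /andP[ji2 ji2']; split; split=> // s sj; apply: ji;
    by rewrite mem_cat sj ?orbT.
- move=> i x; have [x0 x1 xS xs xE] : admissible S (set_val x) := set_valP x.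
  split=> [g|]; first exact: x0.
  apply/eqP; rewrite eq_le; apply/andP; split.
    apply: esum_le_seq => B uB; rewrite lee_fin -(xS 1%g i).
    have sC : {subset B <= undup (B ++ S i)} by move=> g; rewrite mem_undup mem_cat => ->.
    have -> : \sum_(g <- S i) set_val x (1%g, i, g) =
        \sum_(g <- undup (B ++ S i)) set_val x (1%g, i, g).
      apply: sum_support => // [|g|g]; [exact: undup_uniq|exact: xs|].
      by rewrite mem_undup mem_cat negb_or => /andP[_]; exact: xs.
    rewrite (sum_split _ uB (undup_uniq _) sC) lerDl.
    by apply: sumr_ge0 => g _; exact: x0.
  by rewrite -(xS 1%g i); exact: (esum_ge_seq (fun g => set_val x (1%g, i, g))).
- move=> i g x; apply: (@continuous_comp _ _ _ set_val (fun y : Y => y (1%g, i, g))).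
    exact: val_cvg.
  exact: coordinate_continuous.
move=> s.
have bound i x : s \in i.1 ->
    (l1norm (translate s (m i x) \- m i (act s x))%R <= (tolerance i)%:E)%E.
  move=> si; have [x0 x1 xS xs xE] : admissible S (set_val x) := set_valP x.
  apply: esum_le_seq => B uB; rewrite lee_fin.
  (* A finite part of the l^1-norm is the pairing with the signs of the
     differences, a function bounded by 1. *)
  pose D g := set_val x (1%g, i, s^-1 * g)%g - set_val x ((1 * s)%g, i, g).
  pose phi g := if g \in B then Num.sg (D g) else 0.
  have phi1 g : `|phi g| <= 1.
    by rewrite /phi; case: ifP => _; rewrite ?normr0// normr_sg; case: (_ != _).
  apply: le_trans (xE i s 1%g phi si phi1); apply: le_trans (ler_norm _).
  have -> : \sum_(g <- S i) set_val x (1%g, i, g) * phi (s * g)%g =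
      \sum_(g <- B) set_val x (1%g, i, s^-1 * g)%g * phi g.
    transitivity (\sum_(g <- map (fun g => s^-1 * g)%g B)
        set_val x (1%g, i, g) * phi (s * g)%g).
      apply: sum_support => // [|g|g].
      - by rewrite map_inj_uniq//; exact: mulgI.
      - by move=> gS; rewrite xs// mul0r.
      move=> gB; rewrite /phi ifN ?mulr0//; apply: contra gB => gB.
      by apply/mapP; exists (s * g)%g; rewrite ?mulKg.
    by rewrite big_map; apply: eq_bigr => g _; rewrite mulVKg.
  have -> : \sum_(g <- S i) set_val x ((s * 1)%g, i, g) * phi g =
      \sum_(g <- B) set_val x ((1 * s)%g, i, g) * phi g.
    rewrite mulg1 mul1g; apply: sum_support => // g.
      by move=> gS; rewrite xs// mul0r.
    by rewrite /phi => /negbTE ->; rewrite mulr0.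
  rewrite -sumrB [leLHS]big_seq [leRHS]big_seq; apply: ler_sum => g gB.
  by rewrite -mulrBl -/(D g) /phi gB mulrC -normrEsg.
move=> A A0.
have /nbhs_ballP[e /= e0 eA] : nbhs (0 : R) (fun r => A r%:E) := A0.
exists ([:: s], Num.bound e^-1) => // i [/= sE ni].
have si : s \in i.1 by apply: sE; exact: mem_head.
have tol_lt : tolerance i < e.
  rewrite /tolerance invf_plt ?posrE ?ltr0n//.
  apply: lt_le_trans (archi_boundP (ltW _)) _; first by rewrite invr_gt0.
  by rewrite ler_nat; exact: leqW.
pose sup := ereal_sup [set l1norm (translate s (m i x) \- m i (act s x))%R
  | x in [set: X]].
have sup_le : (sup <= (tolerance i)%:E)%E.
  by apply: ge_ereal_sup => _ [x _ <-]; exact: bound.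
have sup_ge : (0 <= sup)%E.
  pose x : X := exist _ base (mem_set base_adm).
  apply: le_trans (_ : (l1norm (translate s (m i x) \- m i (act s x))%R <= sup)%E).
    by apply: esum_ge0 => g _; rewrite lee_fin.
  by apply: ereal_sup_ubound; exists x.
rewrite /= -/sup; case: sup sup_le sup_ge => // r; rewrite !lee_fin => r_le r_ge.
by apply: eA; rewrite /ball /= sub0r normrN ger0_norm// (le_lt_trans r_le).
Qed.

End Compactification.

(** * Thompson's group T acting on the dyadic points of the circle *)

Section Dynamics.
Variable R : realType.
Implicit Types (x d : R) (s t : thompsonT R).

Definition rotate d x : R :=
  if 0 <= x < 1 then if x + d < 1 then x + d else x + d - 1 else x.

Definition rotate_back d x : R :=
  if 0 <= x < 1 then if d <= x then x - d else x - d + 1 else x.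

Lemma rotate_bij d : 0 <= d < 1 -> bijective (rotate d).
Proof.
move=> /andP[d0 d1]; exists (rotate_back d) => x; rewrite /rotate /rotate_back.
  case: (boolP (0 <= x < 1)) => [/andP[x0 x1]|/negbTE ->//].
  case: (ltP (x + d) 1) => xd.
    by rewrite ifT ?ifT; lra.
  by rewrite ifT ?ifF; lra.
case: (boolP (0 <= x < 1)) => [/andP[x0 x1]|/negbTE ->//].
case: (leP d x) => xd.
  by rewrite ifT ?ifT; lra.
by rewrite ifT ?ifF; lra.
Qed.

Lemma rotate_grid (n : nat) d : 0 <= d < 1 -> dyadic_level n d ->
  dyadic_grid n (rotate d).
Proof.
move=> /andP[d0 d1] ld a la /andP[a0 a1].
have h0 := exp2_gt0 R (- n%:Z).
have a1' := lev_gap la (lev1 R n) a1.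
have dd : dyadic d by apply/dyadicP; exists n.
have ddn1 : dyadic (d - 1).
  apply: dyadicD => //; apply: dyadicN.
  by have := dyadic_exp2 R 0; rewrite expr0z.
exists 0; have [ad|ad] := ltP (a + d) 1.
  have ad' := lev_gap (levD la ld) (lev1 R n) ad.
  exists d; split=> // x /andP[ax xa]; rewrite /rotate expr0z mul1r.
  by rewrite ifT ?ifT; lra.
exists (d - 1); split=> // x /andP[ax xa]; rewrite /rotate expr0z mul1r.
by rewrite ifT ?ifF; lra.
Qed.

Lemma rotate_cyclic d : 0 <= d < 1 -> preserves_cyclic (rotate d).
Proof.
move=> /andP[d0 d1]; apply: cyclic_wlog => x y z x0 xy yz z1.
have rotE u : 0 <= u -> u < 1 ->
    rotate d u = if u + d < 1 then u + d else u + d - 1.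
  by move=> u0 u1; rewrite /rotate u0 u1.
rewrite /cyclic !rotE; try lra.
case: (ltP (x + d) 1) => h1; case: (ltP (y + d) 1) => h2;
  case: (ltP (z + d) 1) => h3; lra.
Qed.

(** The rotation by a dyadic angle belongs to T. *)
Lemma thompsonT_transitive d : dyadic d -> 0 <= d < 1 ->
  exists t, thompsonT_val t 0 = d.
Proof.
move=> /dyadicP[n ld] d01.
have bij : `[< bijective (rotate d) >] by apply/asboolP; exact: rotate_bij.
have rT : in_thompsonT (Permutation bij).
  apply/in_thompsonT_cyclic; split; last exact: rotate_cyclic.
  apply/asboolP; apply: grid_thompsonV (rotate_grid d01 ld) => x.
  by rewrite /= in_itv /= /rotate => /negbTE ->.
exists (ThompsonT rT); rewrite /= /rotate ifT ?lexx ?ltr01// add0r.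
by case/andP: d01 => _ ->.
Qed.

Lemma thompsonT_out t x : x \notin `[0, 1[ -> thompsonT_val t x = x.
Proof. by case: t => f /= /asboolP[/thompsonV_out + _]; apply. Qed.

Lemma thompsonT_maps01 t : maps01 (thompsonT_val t).
Proof. exact: perm_maps01 (@thompsonT_out t). Qed.

Lemma thompsonTM s t x :
  thompsonT_val (s * t)%g x = thompsonT_val s (thompsonT_val t x).
Proof. by []. Qed.

Lemma thompsonTV t x : thompsonT_val t^-1%g (thompsonT_val t x) = x.
Proof. by rewrite -thompsonTM mulVg. Qed.

(** The truncation of the binary expansion of x after n digits; n is an integer
    because elements of T shift it by the exponents of their slopes. *)
Definition dyadic_floor (n : int) x : R := s2val (cid2 (lev_floor n x)).

Lemma dyadic_floor_lev n x : dyadic_level n (dyadic_floor n x).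
Proof. exact: (s2valP (cid2 (lev_floor n x))). Qed.

Lemma dyadic_floor_itv n x :
  dyadic_floor n x <= x < dyadic_floor n x + 2 ^ (- n).
Proof. exact: (s2valP' (cid2 (lev_floor n x))). Qed.

Lemma dyadic_floor_ge n x a : dyadic_level n a -> a <= x -> a <= dyadic_floor n x.
Proof.
move=> la ax; rewrite leNgt; apply/negP => /(lev_gap (dyadic_floor_lev n x) la).
by have := dyadic_floor_itv n x; lra.
Qed.

Lemma dyadic_floor_eq n x a : dyadic_level n a -> a <= x < a + 2 ^ (- n) ->
  a = dyadic_floor n x.
Proof.
move=> la /andP[ax xa]; apply/eqP; rewrite eq_le dyadic_floor_ge//= leNgt.
apply/negP => /(lev_gap la (dyadic_floor_lev n x)).
by have := dyadic_floor_itv n x; lra.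
Qed.

Lemma dyadic_floor01 (n : nat) x : 0 <= x < 1 -> 0 <= dyadic_floor n x < 1.
Proof.
move=> /andP[x0 x1]; rewrite dyadic_floor_ge ?lev0//=.
by apply: le_lt_trans x1; have := dyadic_floor_itv n x; lra.
Qed.

(** On a dyadic cell where t is affine with slope 2^l, the standard interval of
    length 2^-k containing x is mapped onto a standard interval of length
    2^(l - k), so its left endpoint goes to the truncation of t x. The exponent
    l depends on x but not on k, which is what makes the averages over k
    almost equivariant. *)
Lemma thompsonT_floor t : exists M : nat, forall x, 0 <= x < 1 ->
  exists l : int, (`|l| <= M)%N /\ forall k : int, M%:Z <= k ->
    thompsonT_val t (dyadic_floor k x) =
    dyadic_floor (k - l) (thompsonT_val t x).
Proof.
have [n gt] : exists n, dyadic_grid n (thompsonT_val t).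
  case: t => f /= /asboolP[fV _].
  have fout := thompsonV_out fV.
  exact: thompsonV_grid (perm_maps01 fout) (@perm_inj01 _ f) (perm_surj01 fout) fV.
have [M hM] := grid_bound gt; exists (n + M + M)%N => x x01.
have [a [la /andP[ax xa] a01 _]] := lev_floor01 n x01.
have [l [b [lM Ml lb h]]] := hM a la a01.
exists l; split; first by lia.
move=> k kM.
have /andP[fx xf] := dyadic_floor_itv k x.
have af : a <= dyadic_floor k x.
  by apply: dyadic_floor_ge ax; apply: lev_le la; lia.
have l0 := exp2_gt0 R l.
rewrite !h ?ax ?af ?xa ?(le_lt_trans fx xa)//.
apply: dyadic_floor_eq.
  apply: levD; first exact/lev_mul/dyadic_floor_lev.
  by apply: lev_le lb; lia.
rewrite lerD2r ler_pM2l// fx /= opprB exp2D addrAC ltrD2r -mulrDr.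
by rewrite ltr_pM2l.
Qed.

(** Shifting a window of summation by one replaces one term, which costs at most
    2; a shift by l is |l| such steps. *)
Lemma shift_average (f : int -> R) (n : nat) (j l : int) :
  (forall i, `|f i| <= 1) ->
  `|\sum_(k < n) f (j + k%:Z) - \sum_(k < n) f (j + k%:Z - l)| <= 2 * `|l|%N%:R.
Proof.
move=> f1; pose g (i : int) : R := \sum_(k < n) f (i + k%:Z).
have step i : `|g i - g (i + 1)| <= 2.
  have -> : g i - g (i + 1) = f i - f (i + n%:Z).
    apply/eqP; rewrite subr_eq addrAC eq_sym subr_eq; apply/eqP.
    rewrite /g; transitivity (\sum_(k < n.+1) f (i + k%:Z)).
      rewrite big_ord_recl addr0; congr (_ + _); apply: eq_bigr => k _.
      by congr f; rewrite lift0; lia.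
    by rewrite big_ord_recr.
  by apply: le_trans (ler_normB _ _) _; have := f1 i; have := f1 (i + n%:Z); lra.
have steps i (m : nat) : `|g i - g (i + m%:Z)| <= 2 * m%:R.
  elim: m => [|m IH]; first by rewrite addr0 subrr normr0 mulr0.
  have -> : i + m.+1%:Z = i + m%:Z + 1 by lia.
  apply: le_trans (ler_distD (g (i + m%:Z)) _ _) _.
  by have := step (i + m%:Z); rewrite -natr1; lra.
have -> : \sum_(k < n) f (j + k%:Z - l) = g (j - l).
  by apply: eq_bigr => k _; congr f; lia.
rewrite -/(g j); have [l0|l0] := leP 0 l.
  rewrite distrC; have := steps (j - l) `|l|%N.
  by have -> : j - l + `|l|%N = j by lia.
by have := steps j `|l|%N; have -> : j + `|l|%N = j - l by lia.
Qed.

(** The stabiliser of 0 plays the role of F, so that a right invariant function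
    on T is a function of the image of 0; at t it is averaged over the
    truncations of t 0 to M, ..., M + n - 1 digits. *)
Lemma thompsonT_relative_property_A :
  relative_property_A R [set k : thompsonT R | thompsonT_val k 0 = 0].
Proof.
move=> E e e0.
(* M bounds both the exponents of the slopes of the elements of E and the level
   from which they respect truncations; n makes the boundary error 2 M / n at
   most e. *)
have [M hM] : exists M : nat, forall s, s \in E -> forall x, 0 <= x < 1 ->
    exists l : int, (`|l| <= M)%N /\ forall k : int, M%:Z <= k ->
      thompsonT_val s (dyadic_floor k x) =
      dyadic_floor (k - l) (thompsonT_val s x).
  elim: E => [|s E [M hM]]; first by exists 0%N.
  have [M' hM'] := thompsonT_floor s; exists (maxn M M') => s'.
  rewrite in_cons => /orP[/eqP ->|/hM h] x x01.
    have [l [lM hl]] := hM' x x01; exists l; split; first by lia.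
    by move=> k kM; apply: hl; lia.
  have [l [lM hl]] := h x x01; exists l; split; first by lia.
  by move=> k kM; apply: hl; lia.
have [n n0 hn] : exists2 n : nat, (0 < n)%N & 2 * M%:R <= e * n%:R.
  exists (Num.bound (2 * M%:R / e)).+1 => //.
  rewrite [e * _]mulrC -ler_pdivrMr//; apply/ltW.
  apply: (@lt_le_trans _ _ (Num.bound (2 * M%:R / e))%:R); last by rewrite ler_nat.
  by apply: archi_boundP; rewrite divr_ge0 ?mulr_ge0// ltW.
have [L hL] := lev_finite R (M + n).
pose rep d : thompsonT R := xget 1%g [set g | thompsonT_val g 0 = d].
have repP g : thompsonT_val (rep (thompsonT_val g 0)) 0 = thompsonT_val g 0.
  by rewrite /rep; case: xgetP => // /(_ g) [].
have pt01 t : 0 <= thompsonT_val t 0 < 1.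
  by apply: thompsonT_maps01; rewrite lexx ltr01.
pose z t (k : 'I_n) := rep (dyadic_floor (M + k)%N (thompsonT_val t 0)).
have zE t k : thompsonT_val (z t k) 0 = dyadic_floor (M + k)%N (thompsonT_val t 0).
  rewrite /z; have [||g <-] :=
    @thompsonT_transitive (dyadic_floor (M + k)%N (thompsonT_val t 0)).
  - by apply/dyadicP; exists (M + k)%N; exact: dyadic_floor_lev.
  - exact: dyadic_floor01.
  exact: repP.
exists 'I_n, (fun _ _ => n%:R^-1), z, (map rep L); split.
- by move=> _ _; rewrite invr_ge0.
- by move=> _; rewrite sumr_const card_ord -[LHS]mulr_natr mulVf// pnatr_eq0 -lt0n.
- move=> t k; apply/map_f/hL; last exact: dyadic_floor01.
  by apply: lev_le (dyadic_floor_lev _ _); have := ltn_ord k; lia.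
move=> s t phi sE phi1 phiK.
(* A right invariant function is determined by its values on the chosen
   elements moving 0 to a given point. *)
have repK g : thompsonT_val ((rep (thompsonT_val g 0))^-1 * g)%g 0 = 0.
  by rewrite thompsonTM -{2}(repP g) thompsonTV.
have phiE g : phi g = phi (rep (thompsonT_val g 0)).
  by rewrite -[RHS](phiK _ _ (repK g)) mulVKg.
have [l [lM hl]] := hM s sE _ (pt01 t).
pose psi (i : int) := phi (rep (dyadic_floor i (thompsonT_val (s * t)%g 0))).
rewrite distrC -!mulr_sumr -mulrBr normrM ger0_norm ?invr_ge0//.
rewrite mulrC ler_pdivrMr ?ltr0n//; apply: le_trans hn.
apply: le_trans (_ : 2 * `|l|%N%:R <= _); last by rewrite ler_wpM2l// ler_nat.
have := @shift_average psi n M l (fun=> phi1 _); congr (`|_ - _| <= _).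
apply: eq_bigr => k _.
by rewrite [RHS]phiE thompsonTM zE hl//; lia.
Qed.

Lemma thompsonF_in_T (f : thompsonF R) : in_thompsonT (thompsonF_val f).
Proof. by case: f => f /= /asboolP[fT _]; apply/asboolP. Qed.

Definition thompsonF_to_T (f : thompsonF R) : thompsonT R :=
  ThompsonT (thompsonF_in_T f).

Lemma thompsonF_to_TM :
  {morph thompsonF_to_T : f g / (f * g)%g >-> (f * g)%g}.
Proof. by move=> f g; exact: val_inj. Qed.

Lemma thompsonF_to_T_inj : injective thompsonF_to_T.
Proof. by move=> f g /(congr1 (@thompsonT_val R)) fg; exact: val_inj. Qed.

Lemma range_thompsonF_to_T :
  range thompsonF_to_T = [set k : thompsonT R | thompsonT_val k 0 = 0].
Proof.
apply/seteqP; split=> [_ [[f fF] _ <-]|k k0] /=; first by have /asboolP[] := fF.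
have kF : in_thompsonF (thompsonT_val k).
  by apply/asboolP; split=> //; apply/asboolP; case: (k).
by exists (ThompsonF kF) => //; exact: val_inj.
Qed.

End Dynamics.

Theorem corollary2p7 (R : realType) :
  exact_group R (thompsonF R) <-> exact_group R (thompsonT R).
Proof.
have iM := @thompsonF_to_TM R; have iI := @thompsonF_to_T_inj R.
split=> /exact_property_A A; apply: property_A_exact.
  apply: (property_A_extension iM iI _ A).
  by rewrite range_thompsonF_to_T; exact: thompsonT_relative_property_A.
exact: (property_A_subgroup iM iI A).
Qed.
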